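(* Let $(R,\mathfrak m)$ be a Noetherian local ring of dimension $d$, $M$ a nonzero finitely generated $R$-module, and $\varphi:M\times M\to R$ an $R$-bilinear homomorphism such that $\varphi(x,y)=\varphi(y,x)$ and $\varphi(x,y)z=\varphi(y,z)x$ for all $x,y,z\in M$, and $\varphi(M\times M)\subseteq\mathfrak m$. Let $A=R\times_\varphi M$. Then the following hold true. (1) If $d=0$, then $A$ is never regular. (2) If $d=1$, then $A$ is regular if and only if $R$ is a discrete valuation ring, $M\cong R$, and $\varphi(M,M)=\mathfrak m$. (3) If $d=2$, then $A$ is regular if and only if one of the following holds. (i) $R$ is a regular local ring, $M\cong R$, and $\varphi(\mathbf e,\mathbf e)\notin\mathfrak m^2$, where $\mathbf e$ denotes a free basis of $M$. (ii) The following hold true: (a) $R$ is a non-regular hypersurface domain; (b) $M\cong I$ for some ideal $I$ of $R$ such that $\mu_R(I)=2$ and $\mu_R(I^2)=3$; (c) $\varphi(M,M)=\mathfrak m$.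
   Context: All rings are commutative. $R\times_\varphi M$ denotes the commutative ring with underlying additive group $R\oplus M$ and multiplication $(a,x)(b,y)=(ab+\varphi(x,y),\,ay+bx)$; under the assumptions it is a local ring with maximal ideal $\mathfrak m\times M$. $\varphi(M,M)$ denotes the ideal of $R$ generated by all $\varphi(x,y)$ with $x,y\in M$. $\mu_R(N)$ is the minimal number of generators of a finitely generated $R$-module $N$, and $v(R)=\mu_R(\mathfrak m)$ is the embedding dimension. $R$ is called hypersurface if $v(R)\le d+1$. *)

(* Defs.v *)
From HB Require Import structures.
From mathcomp Require Import all_boot all_order all_algebra.
From mathcomp Require Import ring_quotient sesquilinear.
From mathcomp Require Import boolp classical_sets functions.
From mathcomp Require Import ring.
Set Implicit Arguments.
Unset Strict Implicit.
Unset Printing Implicit Defensive.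
Import GRing.Theory.
Local Open Scope classical_set_scope.
Local Open Scope ring_scope.

Section Modules.
Variable R : comNzRingType.
Implicit Types U V : lmodType R.

Definition submodule V (N : set V) : Prop := submod_closed [in N].

Definition span V (S : set V) : set V := smallest (@submodule V) S.

Definition generated_by V (N : set V) (n : nat) : Prop :=
  exists x : 'I_n -> V, N = span (range x).

Definition finitely_generated V (N : set V) : Prop :=
  exists n, generated_by N n.

(* [mu N n] is the graph of the (partial) function [N |-> mu_R(N)]. *)
Definition mu V (N : set V) (n : nat) : Prop :=
  generated_by N n /\ forall k, generated_by N k -> (n <= k)%N.

Definition isomorphic U V (N : set V) : Prop :=
  exists f : {linear U -> V}, set_bij [set: U] N f.

Definition free_generator V (e : V) : Prop := bijective (fun r : R => r *: e).

End Modules.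

Section Rings.
Variable R : comNzRingType.
Implicit Types I J P m : set R.

(* Ideals of [R] are the submodules of the regular module [R^o];
   [idealr_closed] below additionally demands properness. *)
Definition ideal I : Prop := submodule (I : set R^o).

Definition ideal_gen (S : set R) : set R := span (S : set R^o).

Definition ideal_mul I J : set R :=
  ideal_gen [set c | exists a b, [/\ I a, J b & c = a * b]].

Definition prime_ideal P : Prop :=
  idealr_closed [in P] /\ prime_idealr_closed [in P].

Definition maximal_ideal m : Prop :=
  idealr_closed [in m] /\
  forall J, idealr_closed [in J] -> m `<=` J -> J = m.

Definition local_ring m : Prop :=
  maximal_ideal m /\ forall m', maximal_ideal m' -> m' = m.

Definition noetherian : Prop :=
  forall I, ideal I -> finitely_generated (I : set R^o).

Definition prime_chain (n : nat) : Prop :=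
  exists P : nat -> set R,
    (forall i, (i <= n)%N -> prime_ideal (P i)) /\
    (forall i, (i < n)%N -> P i `<` P i.+1).

(* [krull_dim d] is the assertion [dim R = d]. *)
Definition krull_dim (d : nat) : Prop :=
  prime_chain d /\ forall n, prime_chain n -> (n <= d)%N.

(* [embdim v] is the assertion that [R] is local with [v(R) = v]. *)
Definition embdim (v : nat) : Prop :=
  exists m, local_ring m /\ mu (m : set R^o) v.

Definition regular_local : Prop :=
  noetherian /\ exists d, krull_dim d /\ embdim d.

Definition hypersurface : Prop :=
  exists d v, [/\ krull_dim d, embdim v & (v <= d + 1)%N].

Definition domain : Prop := GRing.integral_domain_axiom R.

(* A discrete valuation ring is a local principal ideal domain that is not
   a field. *)
Definition dvr : Prop :=
  [/\ domain,
      forall I, ideal I -> exists a, I = ideal_gen [set a]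
    & exists m, local_ring m /\ m <> [set 0]].

End Rings.

Section Extension.
Variables (R : comNzRingType) (M : lmodType R) (phi : {biscalar M}).

Definition phi_sym : Prop := forall x y : M, phi x y = phi y x.
Definition phi_assoc : Prop :=
  forall x y z : M, phi x y *: z = phi y z *: x.

Definition phi_ideal : set R :=
  ideal_gen [set c | exists x y : M, c = phi x y].

Hypotheses (phiC : phi_sym) (phiA : phi_assoc).

(* The proofs are parameters so that the ring structure can be attached
   to this type rather than to the product ring structure on pairs. *)
Definition extension of phi_sym & phi_assoc : Type := (R * M)%type.

Local Notation A := (extension phiC phiA).

HB.instance Definition _ := GRing.Zmodule.copy A (R * M)%type.

Definition ext_one : A := (1, 0).
Definition ext_mul (u v : A) : A :=
  (u.1 * v.1 + phi u.2 v.2, u.1 *: v.2 + v.1 *: u.2).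

Fact ext_mulA : associative ext_mul.
Proof.
move=> [a x] [b y] [c z]; rewrite /ext_mul /=; congr pair.
  by rewrite linearDr linearDl !linearZr_LR !linearZl_LR /=; ring.
rewrite !scalerDr !scalerDl !scalerA -!addrA; congr (_ + _).
by rewrite (phiA x y z) (mulrC a c) (mulrC b c) addrA [RHS]addrC.
Qed.

Fact ext_mulC : commutative ext_mul.
Proof.
by move=> u v; rewrite /ext_mul mulrC phiC; congr pair; rewrite addrC.
Qed.

Fact ext_mul1 : left_id ext_one ext_mul.
Proof.
case=> a x; rewrite /ext_mul /=.
by rewrite mul1r linear0l addr0 scale1r scaler0 addr0.
Qed.

Fact ext_mulDl : left_distributive ext_mul +%R.
Proof.
move=> [a x] [b y] [c z]; rewrite /ext_mul /=; congr pair => /=.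
  by rewrite mulrDl linearDl addrACA.
by rewrite scalerDl scalerDr addrACA.
Qed.

Fact ext_one_neq0 : ext_one != 0.
Proof. by apply/eqP => -[] /eqP; rewrite oner_eq0. Qed.

HB.instance Definition _ := GRing.Zmodule_isComNzRing.Build A
  ext_mulA ext_mulC ext_mul1 ext_mulDl ext_one_neq0.

End Extension.

(* Main.v *)
(* The maximal ideal of [A] is [n = m x M] and
   [n^2 = (m^2 + phi(M,M)) x mM], so by Nakayama [n] has at most two generators
   only if either [M = Re] is cyclic and [m = (phi(e,e), b)], or [M] has two
   generators and [phi(M,M) = m]; [A] is integral over [R] (the conjugation
   [(a,x) |-> (a,-x)] provides norms), so [dim A = dim R].  In dimension 2 a
   local ring with two-generated maximal ideal is a domain, so in the second
   case [A] is a domain: then [M] embeds as [I = phi(e,M)], the relation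
   [phi(e,x) phi(e,y) = phi(e,e) phi(x,y)] gives [I^2 ~ m], and the relation
   [p r = q^2] between the three generators [p = phi(e,e)], [q = phi(e,f)],
   [r = phi(f,f)] of [m] is impossible if [R] is regular. *)
Require Import Defs.
From HB Require Import structures.
From mathcomp Require Import all_boot all_order all_algebra.
From mathcomp Require Import ring_quotient sesquilinear.
From mathcomp Require Import boolp classical_sets functions.
From mathcomp Require Import ring zify.
Import GRing.Theory.
Local Open Scope classical_set_scope.
Local Open Scope ring_scope.

Set Implicit Arguments.
Unset Strict Implicit.
Unset Printing Implicit Defensive.

(** All the dimension theory comes from one statement: if [m = (z, y)] and some power of [y] lies in
    [(z)], then no three primes form a strict chain. Taken with [y = z], it forbids a principal [m]
    in dimension two, which is the minimality half of [mu m = 2]. Taken contrapositively, in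
    dimension two no power of [y] vanishes modulo [z]; by Krull's intersection theorem every nonzero
    residue modulo [z] is then a unit times a power of [y], so [(z)] is prime. These primes yield
    both the domain property of a two-generated local ring of dimension two and the contradiction
    between [p r = q ^ 2] and regularity of [R]. The statements about local rings are proved for an
    arbitrary Noetherian local ring and then applied to [R] and to [A] alike; for this, [A] only has
    to be shown local and Noetherian, with the same lengths of prime chains as [R]. Regularity asks
    for exactly [d] generators: upper bounds come from explicit generators, lower bounds from the
    dimension. *)

Local Notation span := Defs.span.

(** * Submodules and their generators *)

Section Submodules.
Variables (R : comNzRingType) (V : lmodType R).
Implicit Types (N L : set V) (C : set R) (s : seq V).

Lemma submoduleP N :
  submodule N <-> N 0 /\ forall a u v, N u -> N v -> N (a *: u + v).
Proof.
split=> [[N0 Nl]|[N0 Nl]]; split.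
- exact/set_mem.
- by move=> a u v Nu Nv; apply/set_mem/Nl; apply/mem_set.
- exact/mem_set.
- by move=> a u v /set_mem Nu /set_mem Nv; apply/mem_set/Nl.
Qed.

Lemma submodule0 N : submodule N -> N 0.
Proof. by case/submoduleP. Qed.

Lemma submoduleD N u v : submodule N -> N u -> N v -> N (u + v).
Proof. by case/submoduleP=> _ Nl Nu Nv; rewrite -[u]scale1r; exact: Nl. Qed.

Lemma submoduleZ N a u : submodule N -> N u -> N (a *: u).
Proof. by case/submoduleP=> N0 Nl Nu; rewrite -[_ *: _]addr0; exact: Nl. Qed.

Lemma submoduleN N u : submodule N -> N u -> N (- u).
Proof. by rewrite -scaleN1r; exact: submoduleZ. Qed.

Lemma submoduleB N u v : submodule N -> N u -> N v -> N (u - v).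
Proof. by move=> sN Nu Nv; apply: submoduleD => //; exact: submoduleN. Qed.

Lemma submodule_span (S : set V) : submodule (span S).
Proof.
apply/submoduleP; split=> [|a u v Su Sv] N [sN SN]; first exact: submodule0.
by apply: submoduleD => //; [apply: submoduleZ => //; exact: Su | exact: Sv].
Qed.

Lemma sub_span (S : set V) : S `<=` span S.
Proof. exact: sub_gen_smallest. Qed.

Lemma span_sub (S N : set V) : submodule N -> S `<=` N -> span S `<=` N.
Proof. exact: smallest_sub. Qed.

End Submodules.

Section LinearCombinations.
Variables (R : comNzRingType) (V : lmodType R).
Implicit Types (N L : set V) (C : set R) (s : seq V).

(** Restricting coefficients to [C] covers both spans ([C = setT]) and the submodule [mN] of
    Nakayama's lemma ([C = m]); recursion on the list splits off one generator at a time. *)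
Fixpoint lincomb C s : set V :=
  if s is x :: s' then
    [set v | exists a w, [/\ C a, lincomb C s' w & v = a *: x + w]]
  else [set 0].

Lemma submodule_lincomb C s : ideal C -> submodule (lincomb C s).
Proof.
move=> iC; elim: s => [|x s IHs] /=.
  apply/submoduleP; split=> // a u v -> ->.
  by rewrite scaler0 addr0.
apply/submoduleP; split.
  exists 0, 0; split; [exact: (submodule0 (V := R^o) iC)|exact: submodule0|].
  by rewrite scale0r addr0.
move=> a _ _ [b [u [Cb su ->]]] [c [v [Cc sv ->]]].
exists (a * b + c), (a *: u + v); split.
- by apply: (submoduleD (V := R^o)) => //; apply: (submoduleZ (V := R^o)).
- by apply: submoduleD => //; exact: submoduleZ.
- by rewrite scalerDr scalerA scalerDl addrACA.
Qed.

Lemma lincomb_mem C s a x : ideal C -> C a -> x \in s -> lincomb C s (a *: x).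
Proof.
move=> iC Ca; elim: s => //= y s IHs; rewrite inE => /orP[/eqP->|/IHs xs].
  exists a, 0; split=> //; last by rewrite addr0.
  exact: (submodule0 (submodule_lincomb _ _)).
exists 0, (a *: x); split=> //; first exact: (submodule0 (V := R^o) iC).
by rewrite scale0r add0r.
Qed.

Lemma lincomb_sub N C s :
  submodule N -> (forall x, x \in s -> N x) -> lincomb C s `<=` N.
Proof.
move=> sN; elim: s => [_ _ ->|x s IHs sub _ [a [w [_ sw ->]]]] /=.
  exact: submodule0.
apply: submoduleD => //; first by apply: submoduleZ => //; exact/sub/mem_head.
by apply: IHs sw => y ys; apply: sub; rewrite inE ys orbT.
Qed.

Lemma ideal_setT : ideal [set: R].
Proof. exact/(submoduleP (V := R^o)). Qed.

Definition fgen N : Prop := exists s, N = lincomb setT s.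

Lemma lincombT_mem s x : x \in s -> lincomb setT s x.
Proof.
by move=> xs; rewrite -[x]scale1r; apply: lincomb_mem => //; exact: ideal_setT.
Qed.

Lemma lincombT_submodule s : submodule (lincomb setT s).
Proof. exact/submodule_lincomb/ideal_setT. Qed.

Lemma generated_byP N n :
  generated_by N n <-> exists2 s, size s = n & N = lincomb setT s.
Proof.
split=> [[x ->]|[s sn ->]].
  exists [seq x i | i <- enum 'I_n]; first by rewrite size_map size_enum_ord.
  apply/seteqP; split.
    apply: span_sub; first exact: lincombT_submodule.
    by move=> _ [i _ <-]; apply/lincombT_mem/map_f; rewrite mem_enum.
  apply: lincomb_sub; first exact: submodule_span.
  by move=> _ /mapP[i _ ->]; apply: sub_span; exists i.
exists (fun i : 'I_n => s`_i); apply/seteqP; split.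
  apply: lincomb_sub; first exact: submodule_span.
  move=> x /(nthP 0)[i]; rewrite sn => lin <-.
  by apply: sub_span; exists (Ordinal lin).
apply: span_sub; first exact: lincombT_submodule.
by move=> _ [i _ <-]; apply/lincombT_mem/mem_nth; rewrite sn.
Qed.

Lemma fgenP N : finitely_generated N <-> fgen N.
Proof.
split=> [[n /generated_byP[s _ ->]]|[s ->]]; first by exists s.
by exists (size s); apply/generated_byP; exists s.
Qed.

Lemma generated_by_leq N n k :
  (n <= k)%N -> generated_by N n -> generated_by N k.
Proof.
move=> nk /generated_byP[s sn ->]; apply/generated_byP.
exists (s ++ nseq (k - n) 0); first by rewrite size_cat size_nseq sn subnKC.
apply/seteqP; split; apply: lincomb_sub; try exact: lincombT_submodule.
  by move=> x xs; apply: lincombT_mem; rewrite mem_cat xs.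
move=> x; rewrite mem_cat => /orP[|/nseqP[-> _]]; first exact: lincombT_mem.
exact: (submodule0 (lincombT_submodule _)).
Qed.

Lemma generated_by_submodule N n : generated_by N n -> submodule N.
Proof. by case/generated_byP=> s _ ->; exact: lincombT_submodule. Qed.

End LinearCombinations.

(** * Ideals, primes, and Zorn's lemma *)

Section Ideals.
Variable R : comNzRingType.
Implicit Types (I J P : set R) (S : set R).

Lemma idealD I u v : ideal I -> I u -> I v -> I (u + v).
Proof. exact: (submoduleD (V := R^o)). Qed.

Lemma idealB I u v : ideal I -> I u -> I v -> I (u - v).
Proof. exact: (submoduleB (V := R^o)). Qed.

Lemma idealM I a u : ideal I -> I u -> I (a * u).
Proof. exact: (submoduleZ (V := R^o)). Qed.

Lemma idealMr I a u : ideal I -> I u -> I (u * a).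
Proof. by rewrite mulrC; exact: idealM. Qed.

Lemma ideal0 I : ideal I -> I 0.
Proof. exact: (submodule0 (V := R^o)). Qed.

Lemma idealP I : I 0 -> (forall u v, I u -> I v -> I (u + v)) ->
  (forall a u, I u -> I (a * u)) -> ideal I.
Proof.
move=> I0 ID IM; apply/(submoduleP (V := R^o)); split=> // a u v Iu Iv.
by apply: ID => //; exact: IM.
Qed.

Lemma idealr_closedP I : idealr_closed [in I] <-> ideal I /\ ~ I 1.
Proof.
split=> [[I0 I1 Il]|[iI I1]].
  split; last by move/mem_set; apply/negP.
  split=> // a u v Iu Iv; exact: Il.
split; first exact: (mem_set (ideal0 iI)).
  by apply/negP => /set_mem.
move=> a u v /set_mem Iu /set_mem Iv; apply: mem_set; apply: idealD => //.
exact: idealM.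
Qed.

Lemma prime_idealP P : prime_ideal P <->
  [/\ ideal P, ~ P 1 & forall u v, P (u * v) -> P u \/ P v].
Proof.
split=> [[/idealr_closedP[iP P1] PM]|[iP P1 PM]].
  split=> // u v /mem_set/PM/orP[]/set_mem; [by left|by right].
split; first exact/idealr_closedP.
by move=> u v /set_mem/PM[]/mem_set H; apply/orP; [left|right].
Qed.

Lemma primeX P u k : prime_ideal P -> P (u ^+ k) -> P u.
Proof.
move=> /prime_idealP[iP P1 PM]; elim: k => [/P1//|k IHk].
by rewrite exprS => /PM[].
Qed.

Definition ideal_add I J : set R := [set u + v | u in I & v in J].

Lemma ideal_ideal_add I J : ideal I -> ideal J -> ideal (ideal_add I J).
Proof.
move=> iI iJ; apply: idealP.
- by exists 0; [exact: ideal0|]; exists 0; [exact: ideal0|rewrite addr0].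
- move=> _ _ [a Ia [b Jb <-]] [c Ic [d Jd <-]].
  exists (a + c); first exact: idealD.
  by exists (b + d); [exact: idealD|rewrite addrACA].
- move=> a _ [b Ib [c Jc <-]].
  exists (a * b); first exact: idealM.
  by exists (a * c); [exact: idealM|rewrite mulrDr].
Qed.

Lemma sub_ideal_addl I J : ideal J -> I `<=` ideal_add I J.
Proof.
by move=> iJ u Iu; exists u => //; exists 0; [exact: ideal0|rewrite addr0].
Qed.

Lemma sub_ideal_addr I J : ideal I -> J `<=` ideal_add I J.
Proof.
by move=> iI u Ju; exists 0; [exact: ideal0|exists u => //; rewrite add0r].
Qed.

Definition principal (z : R) : set R := [set c * z | c in setT].

Lemma ideal_principal z : ideal (principal z).
Proof.
apply: idealP; first by exists 0; rewrite ?mul0r.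
  by move=> _ _ [a _ <-] [b _ <-]; exists (a + b); rewrite ?mulrDl.
by move=> a _ [b _ <-]; exists (a * b); rewrite ?mulrA.
Qed.

Lemma principal_id z : principal z z.
Proof. by exists 1; rewrite ?mul1r. Qed.

Lemma principal_sub I z : ideal I -> I z -> principal z `<=` I.
Proof. by move=> iI Iz _ [c _ <-]; exact: idealM. Qed.

Lemma principal_lincomb z : principal z = lincomb setT [:: (z : R^o)].
Proof.
apply/seteqP; split=> [_ [c _ <-]|_ [c [w [_ -> ->]]]].
  by exists c, 0; split=> //; rewrite addr0.
by rewrite addr0; exists c.
Qed.

Lemma ideal_mulP I J a b : I a -> J b -> ideal_mul I J (a * b).
Proof. by move=> Ia Jb; apply: (sub_span (V := R^o)); exists a, b. Qed.

Lemma ideal_ideal_mul I J : ideal (ideal_mul I J).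
Proof. exact: (submodule_span (V := R^o)). Qed.

Lemma ideal_mul_sub I J K : ideal K ->
  (forall a b, I a -> J b -> K (a * b)) -> ideal_mul I J `<=` K.
Proof.
move=> iK H; apply: (span_sub (V := R^o)) => // _ [a [b [Ia Jb ->]]].
exact: H.
Qed.

(** [S] is an arbitrary set, so that one use of Zorn's lemma serves maximal ideals ([S] the
    singleton of 1), lying over (scalars outside a prime) and Krull's intersection theorem (a
    difference of ideals). *)
Lemma exists_maximal_disjoint J S : ideal J -> (forall u, J u -> ~ S u) ->
  exists L, [/\ ideal L, J `<=` L, forall u, L u -> ~ S u &
    forall K, ideal K -> L `<=` K -> (forall u, K u -> ~ S u) -> K `<=` L].
Proof.
move=> iJ JS.
(* Testing [X] through its union with [J] makes the empty chain harmless: its union then stands for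
   [J]. *)
pose P X := ideal (X `|` J) /\ forall u, (X `|` J) u -> ~ S u.
have [F FP Ftot|A [[iA AS] Amax]] := @Zorn_bigcup R P.
  split; last by move=> u [[X /FP[_ XS] Xu]|]; [apply: XS; left|apply: JS].
  apply: idealP; first by right; exact: ideal0.
    move=> u v [[X FX Xu]|Ju] [[Y FY Yv]|Jv].
    - have [XY|YX] := Ftot _ _ FX FY.
        have [Yuv|Juv] :=
          idealD (FP _ FY).1 (or_introl (XY _ Xu)) (or_introl Yv).
        + by left; exists Y.
        + by right.
      have [Yuv|Juv] := idealD (FP _ FX).1 (or_introl Xu) (or_introl (YX _ Yv)).
      + by left; exists X.
      + by right.
    - have [?|?] := idealD (FP _ FX).1 (or_introl Xu) (or_intror Jv).
      + by left; exists X.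
      + by right.
    - have [?|?] := idealD (FP _ FY).1 (or_intror Ju) (or_introl Yv).
      + by left; exists Y.
      + by right.
    - by right; exact: idealD.
  move=> a u [[X FX Xu]|Ju]; last by right; exact: idealM.
  have [?|?] := idealM a (FP _ FX).1 (or_introl Xu).
  - by left; exists X.
  - by right.
exists (A `|` J); split=> // K iK AK KS u Ku.
have [Au|nAu] := pselect (A u); first by left.
have AltK : A `<` K.
  by split; [move=> v Av; apply: AK; left|move=> KA; exact/nAu/KA].
case: (Amax K AltK); rewrite /P (_ : K `|` J = K)//.
by apply: setUidl => v Jv; apply: AK; right.
Qed.

End Ideals.

(** * Local rings and Nakayama's lemma *)

Section LocalRings.
Variables (R : comNzRingType) (m : set R).
Hypothesis R_local : local_ring m.
Implicit Types (I J P : set R).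

Lemma local_ideal : ideal m.
Proof. by case: R_local => -[/idealr_closedP[]]. Qed.

Lemma local_proper : ~ m 1.
Proof. by case: R_local => -[/idealr_closedP[]]. Qed.

Lemma local_sub J : ideal J -> ~ J 1 -> J `<=` m.
Proof.
move=> iJ J1.
have [|L [iL JL L1 Lmax]] := exists_maximal_disjoint (S := [set 1]) iJ.
  by move=> u Ju u1; apply: J1; rewrite -u1.
suff <- : L = m by [].
apply: R_local.2; split.
  by apply/idealr_closedP; split=> // L_1; apply: (L1 1).
move=> K /idealr_closedP[iK K1] LK; apply/seteqP; split=> //; apply: Lmax => //.
by move=> u Ku u1; apply: K1; rewrite -u1.
Qed.

Lemma prime_sub_local P : prime_ideal P -> P `<=` m.
Proof. by move=> /prime_idealP[iP P1 _]; exact: local_sub. Qed.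

Lemma local_unit u : ~ m u -> exists v, v * u = 1.
Proof.
move=> mu; apply: contrapT => uN; apply: mu.
apply: (local_sub (ideal_principal u)); last exact: principal_id.
by case=> v _ vu; apply: uN; exists v.
Qed.

Lemma local_unitB u : m u -> exists v, v * (1 - u) = 1.
Proof.
move=> m_u; apply: local_unit => m1; apply: local_proper.
by rewrite -(subrK u 1); exact: idealD local_ideal m1 m_u.
Qed.

Lemma local_cancel (V : lmodType R) (N : set V) u x :
  submodule N -> ~ m u -> N (u *: x) -> N x.
Proof.
move=> sN /local_unit[v vu] /(submoduleZ v sN).
by rewrite scalerA vu scale1r.
Qed.

Lemma ideal_cancel I u x : ideal I -> ~ m u -> I (u * x) -> I x.
Proof. exact: (local_cancel (V := R^o)). Qed.

(** Induction on the generators: those after [x] lie in [L + Rx], and substituting this into the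
    relation for [x] leaves [(1 - c) x] in [L] with [c] in [m], where [1 - c] is a unit. *)
Lemma nakayama (V : lmodType R) (N L : set V) :
  fgen N -> submodule L ->
  (forall v, N v -> exists l w, [/\ L l,
     span [set a *: x | a in m & x in N] w & v = l + w]) -> N `<=` L.
Proof.
case=> s -> sL NLm.
(* [L] is generalised because the induction replaces it by [L + Rx]. *)
suff H : forall L, submodule L -> (forall v, v \in s ->
    exists l w, [/\ L l, lincomb m s w & v = l + w]) ->
    forall v, v \in s -> L v.
  apply: lincomb_sub => //; apply: H => // v vs.
  have [l [w [Ll Mw ->]]] := NLm _ (lincombT_mem vs).
  exists l, w; split=> //; apply: span_sub w Mw.
    exact: submodule_lincomb local_ideal.
  move=> _ [a ma [x + <-]].
  elim: s x {vs NLm} => /= [_ ->|y s IHs _ [b [z [_ sz ->]]]].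
    by rewrite scaler0.
  exists (a * b), (a *: z); split; first exact: idealMr local_ideal ma.
    exact: IHs.
  by rewrite scalerDr scalerA.
move=> {NLm} {}L {}sL; elim: s L sL => // x s IHs L sL H.
pose L' : set V := [set v | exists2 a, setT a & L (v - a *: x)].
have sL' : submodule L'.
  apply/submoduleP; split.
    by exists 0; rewrite ?scale0r ?subr0//; exact: submodule0.
  move=> a u v [b _ Lu] [c _ Lv]; exists (a * b + c) => //.
  rewrite scalerDl -scalerA opprD addrACA -scalerBr.
  by apply: submoduleD => //; exact: submoduleZ.
have sL'L v : v \in s -> L' v.
  apply: IHs => // {}v vs.
  have [|l [_ [Ll [a [w [ma sw ->]]] ->]]] := H v; first by rewrite inE vs orbT.
  exists (l + a *: x), w; split=> //; last by rewrite addrA.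
  by exists a => //; rewrite addrK.
have Lx : L x.
  have [|l [_ [Ll [a [w [ma sw ->]]]]]] := H x; first exact: mem_head.
  have : exists2 b, m b & L (w - b *: x).
    elim: s w sw sL'L {IHs H} => /= [_ ->|y s IHs _ [b [z [mb sz ->]]]] sL'L.
      exists 0; first exact: ideal0 local_ideal.
      by rewrite scale0r subr0; exact: submodule0.
    have [|c mc Lc] := IHs _ sz.
      by move=> v vs; apply: sL'L; rewrite inE vs orbT.
    have [d _ Ld] := sL'L y (mem_head _ _).
    exists (b * d + c).
      by apply: (idealD local_ideal) => //; exact: (idealMr _ local_ideal).
    rewrite scalerDl -scalerA opprD addrACA -scalerBr.
    by apply: submoduleD => //; exact: submoduleZ.
  case=> b mb Lw xE.
  have mab : m (a + b) by exact: (idealD local_ideal).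
  have [v v1] := local_unitB mab.
  rewrite -[x]scale1r -v1 -scalerA; apply: submoduleZ => //.
  rewrite scalerBl scale1r {1}xE scalerDl opprD -addrA addrACA subrr add0r.
  exact: submoduleD.
move=> v; rewrite inE => /orP[/eqP->//|/sL'L[a _ Lv]].
by rewrite -(subrK (a *: x) v); apply: submoduleD => //; exact: submoduleZ.
Qed.

End LocalRings.

(** * Noetherian rings and modules *)

Section Noetherian.
Variable R : comNzRingType.
Hypothesis R_noetherian : noetherian R.
Implicit Types (I J P : set R).

Lemma noetherian_fgen I : ideal I -> fgen (I : set R^o).
Proof. by move/R_noetherian/fgenP. Qed.

Lemma ascending_chain (K : nat -> set R) : (forall i, ideal (K i)) ->
  (forall i, K i `<=` K i.+1) -> exists j, forall i, K i `<=` K j.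
Proof.
move=> iK K1.
have Kle i j : (i <= j)%N -> K i `<=` K j.
  move=> /subnK <-; elim: (j - i)%N => // n IHn.
  by apply: subset_trans IHn _; exact: K1.
have iU : ideal (\bigcup_i K i).
  apply: idealP; first by exists 0%N => //; exact: ideal0.
    move=> u v [i _ Ku] [j _ Kv]; exists (maxn i j) => //; apply: idealD => //.
    - exact: Kle (leq_maxl _ _) _ Ku.
    - exact: Kle (leq_maxr _ _) _ Kv.
  by move=> a u [i _ Ku]; exists i => //; exact: idealM.
have [s Us] := noetherian_fgen iU.
have [j Kj] : exists j, forall x, x \in s -> K j x.
  have : forall x, x \in s -> (\bigcup_i K i) x.
    by move=> x xs; rewrite Us; exact: lincombT_mem.
  elim: s {Us} => [_|x s IHs sU]; first by exists 0%N.
  have [|j Kj] := IHs; first by move=> y ys; apply: sU; rewrite inE ys orbT.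
  have [i _ Kx] := sU x (mem_head _ _).
  exists (maxn i j) => y; rewrite inE => /orP[/eqP->|/Kj].
    exact: Kle (leq_maxl _ _) _ Kx.
  by apply: Kle; exact: leq_maxr.
exists j => i u Ku; have : (\bigcup_i K i) u by exists i.
by rewrite Us; exact: lincomb_sub (iK j) Kj _.
Qed.

(** The coefficients of [x] in elements of [N] form an ideal [C]; lifts to [N] of generators of [C],
    together with generators of the part of [N] in the span of the remaining list, generate [N]. *)
Lemma noetherian_module (V : lmodType R) (s : seq V) (N : set V) :
  submodule N -> N `<=` lincomb setT s -> fgen N.
Proof.
elim: s N => [|x s IHs] N sN Ns.
  by exists [::]; apply/seteqP; split=> // _ ->; exact: submodule0.
pose C : set R := [set c | exists2 w, lincomb setT s w & N (c *: x + w)].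
have iC : ideal C.
  apply: idealP.
  - exists 0; first exact: (submodule0 (lincombT_submodule s)).
    by rewrite scale0r addr0; exact: submodule0.
  - move=> a b [v sv Na] [w sw Nb]; exists (v + w).
      exact: submoduleD (lincombT_submodule s) sv sw.
    by rewrite scalerDl addrACA; exact: submoduleD.
  - move=> a b [w sw Nb]; exists (a *: w).
      exact: submoduleZ (lincombT_submodule s) sw.
    by rewrite -scalerA -scalerDr; exact: submoduleZ.
have [t Nt] : fgen (N `&` lincomb setT s).
  apply: IHs; last by move=> v [].
  apply/submoduleP; split=> [|a u v [Nu su] [Nv sv]].
    by split; [exact: submodule0|exact: (submodule0 (lincombT_submodule _))].
  have sS := lincombT_submodule s.
  by split; apply: submoduleD => //; exact: submoduleZ.
have [cs Ccs] := noetherian_fgen iC.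
have [t' [Nt' t'P]] : exists t', (forall v, v \in t' -> N v) /\
    forall c, C c -> exists2 v, lincomb setT t' v & lincomb setT s (v - c *: x).
  have csC c : c \in cs -> C c by move=> ccs; rewrite Ccs; exact: lincombT_mem.
  suff : (forall c, c \in cs -> C c) ->
      exists t', (forall v, v \in t' -> N v) /\ forall c, lincomb setT cs c ->
      exists2 v, lincomb setT t' v & lincomb setT s (v - c *: x).
    by rewrite -Ccs; apply.
  elim: cs {Ccs csC} => [_|c cs IHcs csC].
    exists [::]; split=> // _ ->; exists 0 => //.
    by rewrite scale0r subr0; exact: (submodule0 (lincombT_submodule _)).
  have [|t' [Nt' t'P]] := IHcs.
    by move=> d dcs; apply: csC; rewrite inE dcs orbT.
  have [w sw Nw] := csC c (mem_head _ _).
  exists (c *: x + w :: t'); split=> [v|_ [a [d [_ csd ->]]]].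
    by rewrite inE => /orP[/eqP->//|]; exact: Nt'.
  have [v t'v sv] := t'P d csd.
  exists (a *: (c *: x + w) + v); first by exists a, v.
  rewrite [X in lincomb _ _ X](_ : _ = a *: w + (v - d *: x)); last first.
    rewrite scalerDl (_ : (a *: c) *: x = a *: (c *: x)) ?scalerA//.
    by rewrite scalerDr scalerA opprD addrACA [_ + a *: w]addrC addrK.
  apply: submoduleD (lincombT_submodule s) _ sv.
  exact: submoduleZ (lincombT_submodule s) sw.
exists (t' ++ t); apply/seteqP; split; last first.
  apply: lincomb_sub => // v; rewrite mem_cat => /orP[/Nt'//|/lincombT_mem].
  by rewrite -Nt => -[].
have cat1 : lincomb setT t' `<=` lincomb setT (t' ++ t).
  apply: lincomb_sub; first exact: lincombT_submodule.
  by move=> v vt; apply: lincombT_mem; rewrite mem_cat vt.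
have cat2 : lincomb setT t `<=` lincomb setT (t' ++ t).
  apply: lincomb_sub; first exact: lincombT_submodule.
  by move=> v vt; apply: lincombT_mem; rewrite mem_cat vt orbT.
move=> v Nv; have [c [w [_ sw vE]]] := Ns v Nv.
have [|v' t'v' sv'] := t'P c; first by exists w => //; rewrite -vE.
rewrite -(subrK v' v); apply: submoduleD (lincombT_submodule _) _ (cat1 _ t'v').
apply: cat2; rewrite -Nt; split.
  by apply: submoduleB => //; exact: (lincomb_sub sN Nt' t'v').
rewrite (_ : v - v' = w - (v' - c *: x)); last first.
  by rewrite vE opprB addrA [w + _]addrC.
exact: submoduleB (lincombT_submodule s) sw sv'.
Qed.

End Noetherian.

(** * Local rings of small dimension *)

Section LocalNoetherian.
Variables (R : comNzRingType) (m : set R).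
Hypotheses (R_noetherian : noetherian R) (R_local : local_ring m).
Implicit Types (I J P Q : set R).

Let im : ideal m := local_ideal R_local.

Lemma nakayama_ideal I J : ideal I -> ideal J ->
  I `<=` ideal_add J (ideal_mul m I) -> I `<=` J.
Proof.
move=> iI iJ IJ; apply: (nakayama R_local (V := R^o)) => //.
  exact: noetherian_fgen.
move=> v /IJ[l Jl [w mIw <-]]; exists l, w; split=> //.
apply: (span_sub _ _ mIw); first exact: submodule_span.
move=> _ [a [b [ma Ib ->]]]; apply: sub_span.
by exists a => //; exists b.
Qed.

Definition ideal2 (x y : R) : set R :=
  [set u | exists a b, u = a * x + b * y].

Lemma ideal2E x y : ideal2 x y = lincomb setT [:: (x : R^o); y : R^o].
Proof.
apply/seteqP; split=> [_ [a [b ->]]|_ [a [_ [_ [b [_ [_ -> ->]]] ->]]]].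
  by exists a, (b * y); split=> //; exists b, 0; split=> //; rewrite addr0.
by exists a, b; rewrite addr0.
Qed.

Lemma ideal_ideal2 x y : ideal (ideal2 x y).
Proof. by rewrite ideal2E; exact: lincombT_submodule. Qed.

Lemma ideal2C x y : ideal2 x y = ideal2 y x.
Proof.
by apply/seteqP; split=> _ [a [b ->]]; exists b, a; rewrite addrC.
Qed.

Lemma ideal2l x y : ideal2 x y x.
Proof. by exists 1, 0; rewrite mul1r mul0r addr0. Qed.

Lemma ideal2r x y : ideal2 x y y.
Proof. by rewrite ideal2C; exact: ideal2l. Qed.

Lemma ideal2_sub I x y : ideal I -> I x -> I y -> ideal2 x y `<=` I.
Proof.
by move=> iI Ix Iy _ [a [b ->]]; apply: idealD => //; exact: idealM.
Qed.

Fixpoint ideal_pow I k : set R :=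
  if k is k'.+1 then ideal_mul I (ideal_pow I k') else setT.

Lemma ideal_ideal_pow I k : ideal (ideal_pow I k).
Proof. case: k => [|k]; [exact: ideal_setT|exact: ideal_ideal_mul]. Qed.

(** Pigeonhole: a monomial of degree at least [i + j] in [x] and [y] is divisible by [x ^+ i] or by
    [y ^+ j]. *)
Lemma ideal_pow_sub x y K i j k : m = ideal2 x y -> ideal K ->
  K (x ^+ i) -> K (y ^+ j) -> k = (i + j)%N -> ideal_pow m k `<=` K.
Proof.
move=> mE iK Kx Ky kij.
(* The factors of [m] already expanded are recorded in the monomial [x ^+ a * y ^+ b]. *)
suff H n : forall a b, (i + j <= a + b + n)%N -> forall w, ideal_pow m n w ->
    K (x ^+ a * y ^+ b * w).
  by move=> w /(H _ 0%N 0%N); rewrite !mul1r kij; exact.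
elim: n => [|n IHn] a b; rewrite ?addn0 => ab w.
  move=> _; apply: idealMr => //.
  have [ia|ai] := leqP i a.
    by rewrite -(subnK ia) exprD -mulrA mulrC -mulrA; exact: idealMr.
  have jb : (j <= b)%N.
    by rewrite -(leq_add2l i) (leq_trans ab)// leq_add2r ltnW.
  by rewrite -(subnK jb) exprD mulrA; exact: idealM.
apply: (ideal_mul_sub (K := [set w | K (x ^+ a * y ^+ b * w)])) => /=.
  apply: idealP => /=; first by rewrite mulr0; exact: ideal0.
    by move=> u v Ku Kv; rewrite mulrDr; exact: idealD.
  by move=> c u Ku; rewrite mulrCA; exact: idealM.
move=> u v; rewrite {1}mE => -[c [d ->]] nv.
rewrite (_ : _ * _ =
  c * (x ^+ a.+1 * y ^+ b * v) + d * (x ^+ a * y ^+ b.+1 * v)).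
  by apply: idealD => //; apply: idealM => //; apply: IHn => //;
    rewrite (leq_trans ab)// !(addSn, addnS).
by rewrite !exprS; ring.
Qed.

(** With [I] the intersection of all [J + m^k], take [L] maximal among the ideals that contain
    [J + mI] and meet [I] only inside it. Then [L] contains a power of [m], hence [I], so [I] lies
    in [J + mI] and Nakayama's lemma ends the proof. *)
Lemma krull_intersection x y J u : m = ideal2 x y -> ideal J ->
  (forall k, ideal_add J (ideal_pow m k) u) -> J u.
Proof.
move=> mE iJ.
pose I := [set v | forall k, ideal_add J (ideal_pow m k) v].
have iI : ideal I.
  have iJk k := ideal_ideal_add iJ (ideal_ideal_pow m k).
  apply: idealP => [k|v w Iv Iw k|a v Iv k].
  - exact: ideal0.
  - exact: idealD.
  - exact: idealM.
have imI := ideal_ideal_mul m I.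
have iJ' := ideal_ideal_add iJ imI.
have [|L [iL J'L LI Lmax]] :=
    exists_maximal_disjoint (S := I `\` ideal_add J (ideal_mul m I)) iJ'.
  by move=> v J'v [].
(* Let the chain [(L : z ^ j)] stabilise at [j]. If [l + c z ^ j] is in [I], then [z] times it is in
   [mI], so [c z ^ (j+1)], and by stability [c z ^ j], is in [L]. Thus adding [z ^ j] to [L] keeps
   it disjoint from the forbidden set. *)
have Lpow z : m z -> exists j, L (z ^+ j).
  move=> mz; pose K j := [set c | L (z ^+ j * c)].
  have iK j : ideal (K j).
    apply: idealP => [|v w Kv Kw|a v Kv]; rewrite /K /=.
    - by rewrite mulr0; exact: ideal0.
    - by rewrite mulrDr; exact: idealD.
    - by rewrite mulrCA; exact: idealM.
  have [|j Kj] := ascending_chain R_noetherian iK.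
    by move=> j v Kv; rewrite /K /= exprS -mulrA; exact: idealM.
  exists j; apply: (Lmax (ideal_add L (principal (z ^+ j)))).
  - exact/ideal_ideal_add/ideal_principal.
  - exact/sub_ideal_addl/ideal_principal.
  - move=> _ [l Ll [_ [c _ <-] <-]] [Ilc J'lc].
    apply: LI (conj Ilc J'lc); apply: idealD => //.
    rewrite mulrC; apply: (Kj j.+1); rewrite /K /=.
    rewrite (_ : _ * c = z * (l + c * z ^+ j) - z * l); last first.
      by rewrite exprS; ring.
    apply: idealB => //; last exact: idealM.
    by apply/J'L/sub_ideal_addr => //; exact: ideal_mulP.
  - exact: sub_ideal_addr iL _ (principal_id _).
have mx : m x by rewrite mE; exact: ideal2l.
have my : m y by rewrite mE; exact: ideal2r.
have [i Li] := Lpow x mx; have [j Lj] := Lpow y my.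
have IJ : I `<=` J.
  apply: nakayama_ideal => // v Iv.
  have Lv : L v.
    have [v1 Jv [v2 mv <-]] := Iv (i + j)%N; apply: idealD => //.
      by apply/J'L/sub_ideal_addl.
    exact: (ideal_pow_sub mE iL Li Lj erefl).
  by apply: contrapT => nJ'v; exact: LI Lv (conj Iv nJ'v).
exact: IJ.
Qed.

(* Krull's principal ideal theorem for [z]: localising at [Q] is avoided by
   using the contractions [I_ j] of the powers of a single [a] in [Q \ P],
   which stabilise modulo [z] because [R / z] is a chain ring of finite
   length. *)
Lemma no_prime_chain2 z y k : m = ideal2 z y -> principal z (y ^+ k) ->
  ~ prime_chain R 2.
Proof.
move=> mE yk [p [pP plt]].
have pP0 := pP 0%N isT; have pP1 := pP 1%N isT; have pP2 := pP 2%N isT.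
have [P01 nP10] := plt 0%N isT; have [P12 nP21] := plt 1%N isT.
set P := p 0%N in pP0 P01 nP10; set Q := p 1%N in pP1 P01 nP10 P12 nP21.
have mz : m z by rewrite mE; exact: ideal2l.
have my : m y by rewrite mE; exact: ideal2r.
have [iP _ PM] := (prime_idealP P).1 pP0.
have [iQ Q1 QM] := (prime_idealP Q).1 pP1.
have Qz : ~ Q z.
  move=> Qz; apply: nP21 => u /(prime_sub_local R_local pP2).
  rewrite mE; apply: ideal2_sub => //; apply: (primeX (k := k)) pP1 _.
  exact: principal_sub iQ Qz _ yk.
have [a Qa nPa] : exists2 a, Q a & ~ P a.
  apply: contrapT => H; apply: nP10 => a Qa; apply: contrapT => nPa.
  by apply: H; exists a.
(* The elements whose image in the localisation of [R / P] at [Q] is a multiple of [a ^ j], with the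
   denominator [s] cleared. *)
pose I_ j := [set u | exists s b, ~ Q s /\ P (s * u - a ^+ j * b)].
have iI j : ideal (I_ j).
  apply: idealP.
  - by exists 1, 0; split=> //; rewrite !mulr0 subr0; exact: ideal0.
  - move=> u v [s [b [Qs Ps]]] [t [c [Qt Pt]]]; exists (s * t), (t * b + s * c).
    split; first by case/QM.
    rewrite (_ : _ - _ = t * (s * u - a ^+ j * b) + s * (t * v - a ^+ j * c)).
      by apply: idealD => //; exact: idealM.
    by ring.
  - move=> c u [s [b [Qs Ps]]]; exists s, (c * b); split=> //.
    rewrite (_ : _ - _ = c * (s * u - a ^+ j * b)); first exact: idealM.
    by ring.
have I1 j : I_ j.+1 `<=` I_ j.
  move=> u [s [b [Qs Ps]]]; exists s, (a * b); split=> //.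
  by rewrite mulrA -exprSr.
pose Iz j := ideal_add (I_ j) (principal z).
have iIz j : ideal (Iz j) by exact/ideal_ideal_add/ideal_principal.
(* The order in [y] of [I_ j] modulo [z] is at least [i]. These orders are bounded by [k]; at a [j]
   where the bound is largest, [I_ j.+1] cannot exceed it, which forces [I_ j] into
   [I_ j.+1 + (z)]. *)
pose low i j := forall i', (i' < i)%N -> ~ Iz j (y ^+ i').
have [j Ij] : exists j, I_ j `<=` Iz j.+1.
  have [|i lowi|i /asboolP[j lowj] imax] :=
      @ex_maxnP (fun i => `[< exists j, low i j >]) k.
  - by exists 0%N; apply/asboolP; exists 0%N.
  - move: lowi => /asboolP[j lowj]; rewrite leqNgt; apply/negP => /lowj; apply.
    exact: sub_ideal_addr.
  exists j => u Iu; apply: contrapT => nIzu.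
  have Izi : Iz j.+1 (y ^+ i).
    apply: contrapT => nIzi; suff : (i < i)%N by rewrite ltnn.
    apply: imax; apply/asboolP; exists j.+1 => i'; rewrite ltnS leq_eqVlt.
    case/orP=> [/eqP->//|/lowj nIz [v Iv [w zw vw]]]; apply: nIz.
    by exists v; [exact: I1|exists w].
  have H n : (n <= i)%N -> exists c d, u = c * z + d * y ^+ n.
    elim: n => [|n IHn] ni; first by exists 0, u; ring.
    have [c [d uE]] := IHn (ltnW ni).
    have [md|/(local_unit R_local)[e ed]] := pselect (m d).
      move: md; rewrite mE => -[c' [d' dE]].
      exists (c + c' * y ^+ n), d'; rewrite uE dE exprS; ring.
    case: (lowj _ ni); exists (e * u); first exact: idealM.
    exists (- (e * c) * z); first by exists (- (e * c)).
    rewrite uE -[RHS]mul1r -ed; ring.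
  have [c [d uE]] := H i (leqnn i); apply: nIzu; rewrite uE.
  apply: idealD => //; last exact: idealM.
  by apply: sub_ideal_addr => //; exists c.
(* In [u = v + w z] the term [w z] lies in [I_ j], and [z], being outside [Q], cancels. Hence [w] is
   in [I_ j], and [I_ j] lies in [I_ j.+1 + m I_ j]. *)
have II : I_ j `<=` I_ j.+1.
  apply: nakayama_ideal => // u Iu.
  have [v Iv [_ [w _ <-] uE]] := Ij u Iu; exists v => //; exists (w * z) => //.
  rewrite mulrC; apply: ideal_mulP => //.
  have : I_ j (w * z).
    by rewrite -(addKr v (w * z)) uE addrC; apply: idealB => //; exact: I1.
  case=> s [b [Qs Ps]]; exists (s * z), b; split; first by case/QM.
  by rewrite -mulrA (mulrC z).
(* Now [a ^ j (s - a b)] is in [P] and [a] is not, so [s] falls into [Q]. *)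
have [|s [b [Qs Ps]]] := II (a ^+ j).
  exists 1, 1; split=> //; rewrite mul1r mulr1 subrr; exact: ideal0.
apply: Qs; case: (PM (a ^+ j) (s - a * b)).
- by rewrite mulrBr mulrA -exprSr mulrC.
- by move/(primeX pP0).
- move/P01 => Qsab; rewrite -(subrK (a * b) s); apply: idealD => //.
  exact: idealMr.
Qed.

(** Modulo [z], an element that is divisible by every power of [y] vanishes by Krull's intersection
    theorem, so any other is a unit times some [y ^ k]; a product of two such is a unit times a
    power of [y]. *)
Lemma prime_principal z y : m = ideal2 z y ->
  (forall k, ~ principal z (y ^+ k)) -> prime_ideal (principal z).
Proof.
move=> mE nyk; have iz := ideal_principal z.
have my : m y by rewrite mE; exact: ideal2r.
have powE k : ideal_pow m k `<=` ideal2 z (y ^+ k).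
  elim: k => [|k IHk] /=; first by move=> u _; exists 0, u; ring.
  apply: ideal_mul_sub; first exact: ideal_ideal2.
  move=> a b; rewrite {1}mE => -[c [d ->]] /IHk[e [f ->]].
  exists (c * e * z + c * f * y ^+ k + d * e * y), (d * f).
  by rewrite exprS; ring.
have order u : ~ principal z u ->
    exists k, exists2 e, ~ m e & principal z (u - e * y ^+ k).
  move=> nzu; apply: contrapT => H; apply: nzu.
  apply: (krull_intersection mE iz) => k.
  suff [e [w [we we']]] :
      exists e w, ideal_pow m k w /\ principal z (u - e * w).
    exists (u - e * w) => //; exists (e * w); rewrite ?subrK//.
    exact: idealM (ideal_ideal_pow m k) we.
  suff [e ze] : exists e, principal z (u - e * y ^+ k).
    exists e, (y ^+ k); split=> //; elim: k {ze} => //= k IHk.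
    by rewrite exprS; exact: ideal_mulP.
  elim: k => [|k [e ze]]; first by exists u; rewrite mulr1 subrr; exact: ideal0.
  have [|nme] := pselect (m e); last by case: H; exists k, e.
  rewrite {1}mE => -[a [b eE]]; exists b.
  rewrite (_ : _ - _ = (u - e * y ^+ k) + a * y ^+ k * z).
    by apply: idealD => //; exists (a * y ^+ k).
  by rewrite eE exprS; ring.
apply/prime_idealP; split=> // [z1|u v zuv].
  apply: (nyk 0%N); exact: z1.
apply: contrapT => H.
have [|k [e nme ze]] := order u; first by move=> zu; apply: H; left.
have [|l [f nmf zf]] := order v; first by move=> zv; apply: H; right.
apply: (nyk (k + l)%N).
apply: (ideal_cancel R_local iz nme); apply: (ideal_cancel R_local iz nmf).
rewrite (_ : _ * _ =
  u * v - (u - e * y ^+ k) * v - e * y ^+ k * (v - f * y ^+ l)).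
  apply: idealB => //; last exact: idealM.
  by apply: idealB => //; exact: idealMr.
by rewrite exprD; ring.
Qed.

End LocalNoetherian.

(** * Principal and two-generated maximal ideals *)

Section SmallDimension.
Variables (R : comNzRingType) (m : set R).
Hypotheses (R_noetherian : noetherian R) (R_local : local_ring m).
Implicit Types (I J P Q : set R).

Let im : ideal m := local_ideal R_local.

Lemma generated_by2P I :
  generated_by (I : set R^o) 2 <-> exists x y, I = ideal2 x y.
Proof.
split=> [/generated_byP[[|x [|y []]]// _ ->]|[x [y ->]]].
  by exists x, y; rewrite ideal2E.
by apply/generated_byP; exists [:: x : R^o; y : R^o] => //; rewrite ideal2E.
Qed.

Lemma generated_by1P I :
  generated_by (I : set R^o) 1 <-> exists x, I = principal x.
Proof.
split=> [/generated_byP[[|x []]// _ ->]|[x ->]].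
  by exists x; rewrite principal_lincomb.
by apply/generated_byP; exists [:: x : R^o] => //; rewrite principal_lincomb.
Qed.

Lemma embdimP v : embdim R v <-> mu (m : set R^o) v.
Proof.
split=> [[m' [lm']]|mv]; last by exists m.
by rewrite (R_local.2 m' lm'.1).
Qed.

Lemma krull_dim_uniq (S : comNzRingType) d e :
  krull_dim S d -> krull_dim S e -> d = e.
Proof.
by move=> [cd dP] [ce eP]; apply/eqP; rewrite eqn_leq eP// dP.
Qed.

Lemma regular_local_mu d : krull_dim R d ->
  regular_local R <-> mu (m : set R^o) d.
Proof.
move=> dimd; split=> [[_ [e [dime /embdimP]]]|mud].
  by rewrite (krull_dim_uniq dimd dime).
by split=> //; exists d; split=> //; exact/embdimP.
Qed.

Lemma ideal2_id (z : R) : ideal2 z z = principal z.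
Proof.
apply/seteqP; split; last exact: principal_sub (ideal_ideal2 _ _) (ideal2l _ _).
by move=> _ [a [b ->]]; exists (a + b); rewrite // mulrDl.
Qed.

Lemma not_principal_max (z : R) : prime_chain R 2 -> m <> principal z.
Proof.
rewrite -ideal2_id => c2 mE.
exact: (no_prime_chain2 R_noetherian R_local mE (k := 1%N)) (principal_id z) c2.
Qed.

Lemma not_generated_by1 : prime_chain R 2 -> ~ generated_by (m : set R^o) 1.
Proof. by move=> c2 /generated_by1P[z]; exact: not_principal_max. Qed.

Lemma mu2_max x y : prime_chain R 2 -> m = ideal2 x y -> mu (m : set R^o) 2.
Proof.
move=> c2 mE; split; first by apply/generated_by2P; exists x, y.
move=> k mk; rewrite leqNgt; apply/negP; rewrite ltnS => k1.
exact: not_generated_by1 c2 (generated_by_leq k1 mk).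
Qed.

Lemma prime_generator (z y : R) :
  m = ideal2 z y -> prime_chain R 2 -> prime_ideal (principal z).
Proof.
move=> mE c2; apply: (prime_principal R_noetherian R_local mE) => k zyk.
exact: (no_prime_chain2 R_noetherian R_local mE zyk c2).
Qed.

(* The primes [(x + y ^ i)], [i > 0], are pairwise incomparable, so a nonzero
   element lies in finitely many of them, by Krull's intersection theorem. *)
Lemma domain_dim2 x y : m = ideal2 x y -> prime_chain R 2 -> domain R.
Proof.
(* The exponent starts at 1 so that every [z i] is in [m] and, with [y], generates it. *)
move=> mE c2; pose z i := x + y ^+ i.+1.
have my : m y by rewrite mE; exact: ideal2r.
have mzE i : m = ideal2 (z i) y.
  rewrite mE; apply/seteqP; split; apply: ideal2_sub; try exact: ideal_ideal2.
  - by exists 1, (- y ^+ i); rewrite /z exprS; ring.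
  - exact: ideal2r.
  - by exists 1, (y ^+ i); rewrite /z exprS; ring.
  - exact: ideal2r.
have mz i : m (z i) by rewrite (mzE i); exact: ideal2l.
have pz i : prime_ideal (principal (z i)) by exact: prime_generator c2.
have nzy i k : ~ principal (z i) (y ^+ k).
  by move=> zyk; exact: (no_prime_chain2 R_noetherian R_local (mzE i) zyk c2).
have zB i j c : (i < j)%N ->
    c * z i - c * z j = c * (1 - y ^+ (j - i)) * y ^+ i.+1.
  move=> ij; rewrite /z (_ : y ^+ j.+1 = y ^+ (j - i) * y ^+ i.+1); first ring.
  by rewrite -exprD; congr (_ ^+ _); lia.
(* Otherwise the difference [zB] puts a unit times a power of [y] in [(z j)]. With truncated
   subtraction, [(i - j) + (j - i)] is the distance of [i] and [j], whichever is larger. *)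
have nzz i j : i != j -> ~ principal (z j) (z i).
  move=> ij zz; have [u uE] : exists u, u * (1 - y ^+ ((i - j) + (j - i))) = 1.
    apply: (local_unitB R_local); case E: (_ + _)%N => [|n].
      by case/eqP: ij; lia.
    by rewrite exprSr; exact: idealM.
  move: ij uE; rewrite neq_ltn => /orP[] ij.
    rewrite (_ : (i - j = 0)%N) ?add0n => [uE|]; last lia.
    apply: (nzy j i.+1); rewrite -[y ^+ _]mul1r -uE -zB//.
    apply: idealB (idealM _ _ _) (idealM _ _ (principal_id _)) => //;
      exact: ideal_principal.
  rewrite (_ : (j - i = 0)%N) ?addn0 => [uE|]; last lia.
  apply: (nzy j j.+1); rewrite -[y ^+ _]mul1r -uE -zB//.
  apply: idealB (idealM _ _ (principal_id _)) (idealM _ _ _) => //;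
    exact: ideal_principal.
(* If [u = c z_i] is outside [m^(k+1)], then [c] is outside [m^k]; for [j > i] the prime [(z j)]
   omits [z i], so it contains [u] only if it contains [c]. *)
have fin k : forall u, ~ ideal_pow m k u ->
    exists n, forall i, (n <= i)%N -> ~ principal (z i) u.
  elim: k => [|k IHk] u nu; first by case: nu.
  have [[i [c _ uE]]|H] := pselect (exists i, principal (z i) u); last first.
    by exists 0%N => i _ zu; apply: H; exists i.
  have [|n nP] := IHk c.
    by move=> mc; apply: nu; rewrite -uE mulrC; exact: ideal_mulP.
  exists (maxn n i.+1) => j; rewrite geq_max => /andP[nj ij].
  have [_ _ PM] := (prime_idealP _).1 (pz j).
  rewrite -uE => /PM[]; first exact: nP.
  by apply: nzz; rewrite ltn_eqF.
have fin0 u : u != 0 -> exists n, forall i, (n <= i)%N -> ~ principal (z i) u.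
  move=> u0; have [[k]|H] := pselect (exists k, ~ ideal_pow m k u).
    exact: fin.
  case/eqP: u0; have i0 : ideal (principal (0 : R)) by exact: ideal_principal.
  have [|c _ <-] := krull_intersection R_noetherian R_local mE i0 (u := u).
    move=> k; apply: sub_ideal_addr => //; apply: contrapT => nu.
    by apply: H; exists k.
  by rewrite mulr0.
move=> u v uv0; apply: contrapT => /negP; rewrite negb_or.
case/andP=> /fin0[n nP] /fin0[n' nP'].
have [iz _ PM] := (prime_idealP _).1 (pz (maxn n n')).
have : principal (z (maxn n n')) (u * v) by rewrite uv0; exact: ideal0.
case/PM; first exact/nP/leq_maxl.
exact/nP'/leq_maxr.
Qed.

(** In [p = c a + d b] one coefficient is a unit, since [p] is not in [m^2]; [p] then replaces the
    generator it multiplies. *)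
Lemma exchange_generator a b p : m = ideal2 a b -> m p -> ~ ideal_mul m m p ->
  exists y, m = ideal2 p y.
Proof.
move=> mE mp; have := mp; rewrite {1}mE => -[c [d pE]] nmmp.
have ma : m a by rewrite mE; exact: ideal2l.
have mb : m b by rewrite mE; exact: ideal2r.
have [mc|nmc] := pselect (m c).
  have [md|nmd] := pselect (m d).
    case: nmmp; rewrite pE; apply: (idealD (ideal_ideal_mul m m)).
      exact: ideal_mulP.
    exact: ideal_mulP.
  exists a; apply/seteqP; split; last exact: ideal2_sub.
  rewrite mE; apply: ideal2_sub; [exact: ideal_ideal2|exact: ideal2r|].
  apply: (ideal_cancel R_local (ideal_ideal2 _ _) nmd).
  by exists 1, (- c); rewrite pE; ring.
exists b; apply/seteqP; split; last exact: ideal2_sub.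
rewrite mE; apply: ideal2_sub; [exact: ideal_ideal2| |exact: ideal2r].
apply: (ideal_cancel R_local (ideal_ideal2 _ _) nmc).
by exists 1, (- d); rewrite pE; ring.
Qed.

(** A nilpotent [t] would lie in the smaller prime of the chain. Reading [m] as [(0, t)], the
    two-generator criterion makes [(0)] prime; each nonzero element is a unit times a power of [t],
    and a nonzero ideal is generated by the least power of [t] in it. *)
Lemma principal_max_dvr (t : R) : m = principal t -> prime_chain R 1 -> dvr R.
Proof.
move=> mE [p [pP plt]].
have mt : m t by rewrite mE; exact: principal_id.
have mE2 : m = ideal2 0 t.
  rewrite mE; apply/seteqP; split.
    exact: principal_sub (ideal_ideal2 _ _) (ideal2r _ _).
  apply: ideal2_sub; [exact: ideal_principal| |exact: principal_id].
  exact: (ideal0 (ideal_principal _)).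
have nil k : t ^+ k <> 0.
  move=> tk; have pP0 := pP 0%N isT; have [_ np10] := plt 0%N isT.
  apply: np10 => u /(prime_sub_local R_local (pP 1%N isT)).
  have [ip _ _] := (prime_idealP _).1 pP0.
  rewrite mE; apply: principal_sub => //; apply: (primeX (k := k)) => //.
  by rewrite tk; exact: ideal0.
have p0 : prime_ideal (principal (0 : R)).
  apply: (prime_principal R_noetherian R_local mE2) => k [c _].
  by rewrite mulr0 => tk; exact: (nil k).
have [i0 _ pM] := (prime_idealP _).1 p0.
have p00 u : principal 0 u -> u = 0 by case=> c _ <-; rewrite mulr0.
have domR : domain R.
  move=> u v uv0; have : principal 0 (u * v) by rewrite uv0; exact: ideal0.
  by case/pM => /p00 ->; rewrite eqxx ?orbT.
split=> //; last first.
  by exists m; split=> // m0; apply: (nil 1%N); move: mt; rewrite m0.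
move=> I iI; have gen0 (a : R) : ideal_gen [set a] = principal a.
  apply/seteqP; split.
    by apply: (span_sub (ideal_principal a)) => _ ->; exact: principal_id.
  apply: principal_sub; first exact: (@submodule_span R R^o [set a]).
  exact: (@sub_span R R^o [set a] a).
have [[u Iu u0]|H] := pselect (exists2 u, I u & u <> 0); last first.
  exists 0; rewrite gen0; apply/seteqP; split=> [u Iu|_ /p00 ->].
    apply: contrapT => nu; apply: H; exists u => // u0; apply: nu; rewrite u0.
    exact: ideal0.
  exact: ideal0.
have factor v : v <> 0 -> exists k e, ~ m e /\ v = e * t ^+ k.
  move=> v0; apply: contrapT => nv; apply: v0; apply: p00.
  apply: (krull_intersection R_noetherian R_local mE2 i0) => k.
  apply: sub_ideal_addr => //.
  suff [e ->] : exists e, v = e * t ^+ k.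
    apply: idealM; first exact: ideal_ideal_pow.
    by elim: k => //= k IHk; rewrite exprS; exact: ideal_mulP.
  elim: k => [|k [e vE]]; first by exists v; rewrite mulr1.
  have [|nme] := pselect (m e); last by case: nv; exists k, e.
  by rewrite mE => -[c _ eE]; exists c; rewrite vE -eE exprS mulrA.
have ex : exists k, `[< I (t ^+ k) >].
  have [k [e [nme uE]]] := factor u u0; exists k; apply/asboolP.
  by apply: (ideal_cancel R_local iI nme); rewrite -uE.
case: (ex_minnP ex) => k /asboolP Ik kmin.
exists (t ^+ k); rewrite gen0; apply/seteqP; split; last exact: principal_sub.
move=> v Iv; have [->|/eqP v0] := eqVneq v 0.
  exact: (ideal0 (ideal_principal _)).
have [l [e [nme vE]]] := factor v v0.
have kl : (k <= l)%N.
  apply: kmin; apply/asboolP; apply: (ideal_cancel R_local iI nme).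
  by rewrite -vE.
by exists (e * t ^+ (l - k)); rewrite // vE -{2}(subnK kl) exprD mulrA.
Qed.

End SmallDimension.

(** * The extension as a local Noetherian ring *)

Section Extension.
Variables (R : comNzRingType) (m : set R).
Hypotheses (R_noetherian : noetherian R) (R_local : local_ring m).
Variables (M : lmodType R) (phi : {biscalar M}).
Hypotheses (phiC : phi_sym phi) (phiA : phi_assoc phi).
Hypothesis phi_m : forall x y : M, m (phi x y).

Local Notation A := (extension phiC phiA).
Let im : ideal m := local_ideal R_local.

Definition ext_scalar (a : R) : A := (a, 0).
Definition ext_vector (x : M) : A := (0, x).

Lemma ext_mulE (u v : A) :
  u * v = ((u.1 * v.1 + phi u.2 v.2, u.1 *: v.2 + v.1 *: u.2) : A).
Proof. by []. Qed.

Lemma ext_addE (u v : A) : u + v = ((u.1 + v.1, u.2 + v.2) : A).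
Proof. by []. Qed.

Lemma ext_oppE (u : A) : - u = ((- u.1, - u.2) : A).
Proof. by []. Qed.

Lemma ext_scalarM a b : ext_scalar (a * b) = ext_scalar a * ext_scalar b.
Proof. by rewrite ext_mulE /= linear0r !scaler0 !addr0. Qed.

Lemma ext_scalarD a b : ext_scalar (a + b) = ext_scalar a + ext_scalar b.
Proof. by rewrite ext_addE /= addr0. Qed.

Lemma ext_scalarN a : ext_scalar (- a) = - ext_scalar a.
Proof. by rewrite ext_oppE /= oppr0. Qed.

Lemma ext_scalar_mul a (u : A) : ext_scalar a * u = ((a * u.1, a *: u.2) : A).
Proof. by rewrite ext_mulE /= linear0l scaler0 !addr0. Qed.

Lemma ext_vectorM x y : ext_vector x * ext_vector y = ext_scalar (phi x y).
Proof. by rewrite ext_mulE /= mulr0 !scale0r add0r addr0. Qed.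

Definition ext_max : set A := [set u | m u.1].

Lemma ideal_ext_max : ideal ext_max.
Proof.
apply: idealP; first exact: ideal0 im.
  by move=> u v; exact: (idealD im).
by move=> a u mu; apply: (idealD im) => //; exact: (idealM _ im).
Qed.

Definition ext_conj (u : A) : A := (u.1, - u.2).
Definition ext_norm (u : A) : R := u.1 ^+ 2 - phi u.2 u.2.

Lemma ext_conjM u : u * ext_conj u = ext_scalar (ext_norm u).
Proof.
by rewrite ext_mulE /= linearNr scalerN addNr.
Qed.

Lemma ext_conjD u : u + ext_conj u = ext_scalar (u.1 + u.1).
Proof. by rewrite ext_addE /= subrr. Qed.

(** The norm is congruent to [u.1 ^+ 2] modulo [m], hence a unit; the inverse is the conjugate
    divided by the norm. *)
Lemma ext_unit u : ~ ext_max u -> exists v, v * u = 1.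
Proof.
move=> nu; have : ~ m (ext_norm u).
  move=> mN; apply: nu; apply: contrapT => nu.
  have [v vu] := local_unit R_local nu; apply: (local_proper R_local).
  rewrite -[1]mulr1 -{1}vu -vu mulrACA; apply: idealM => //.
  rewrite -expr2 -(subrK (phi u.2 u.2) (_ ^+ 2)).
  exact: idealD.
case/(local_unit R_local) => v vN; exists (ext_scalar v * ext_conj u).
by rewrite -mulrA (mulrC _ u) ext_conjM -ext_scalarM vN.
Qed.

Lemma ext_local : local_ring ext_max.
Proof.
have n1 : ~ ext_max 1 by exact: (local_proper R_local).
have sub J : ideal J -> ~ J 1 -> J `<=` ext_max.
  move=> iJ J1 u Ju; apply: contrapT => /ext_unit[v vu]; apply: J1.
  by rewrite -vu; exact: idealM.
split=> [|n' [/idealr_closedP[in' n'1] n'max]].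
  split=> [|J /idealr_closedP[iJ J1] nJ].
    by apply/idealr_closedP; split=> //; exact: ideal_ext_max.
  by apply/seteqP; split=> //; exact: sub.
apply/esym/n'max; last exact: sub.
by apply/idealr_closedP; split=> //; exact: ideal_ext_max.
Qed.

(** An ideal of [A] is an [R]-submodule of the finite module [R^o * M], and generators over [R] also
    generate over [A]. *)
Lemma ext_noetherian : fgen [set: M] -> noetherian A.
Proof.
move=> [s Ms] J iJ; pose J' : set (R^o * M)%type := J.
have sJ' : submodule J'.
  apply/submoduleP; split; first exact: ideal0 iJ.
  move=> a u v Ju Jv; apply: (idealD iJ _ Jv).
  have := idealM (ext_scalar a) iJ Ju; rewrite ext_scalar_mul; exact.
have [|t Jt] := noetherian_module R_noetherian
    (s := ((1 : R^o), 0) :: [seq (0 : R^o, x) | x <- s]) sJ'.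
  move=> [a x] _ /=.
  exists a, (0 : R^o, x); split=> //; last first.
    by rewrite -[RHS]/(a * 1 + 0, a *: 0 + x) mulr1 addr0 scaler0 add0r.
  have : lincomb setT s x by rewrite -Ms.
  elim: s x {Ms} => [x ->//|y s IHs _ [b [w [_ sw ->]]]] /=.
  exists b, (0 : R^o, w); split=> //; first exact: IHs.
  by rewrite -[RHS]/(b * 0 + 0, b *: y + w) mulr0 addr0.
apply/fgenP; exists t; apply/seteqP; split.
  move=> u Ju; have : lincomb setT t u by rewrite -Jt.
  elim: t u {Jt Ju} => //= y t IHt _ [a [w [_ tw ->]]].
  exists (ext_scalar a), w; split=> //; first exact: IHt.
  by rewrite /GRing.scale /= ext_scalar_mul.
apply: (lincomb_sub (V := A^o)) => // u ut.
have : J' u by rewrite Jt; exact: lincombT_mem.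
by [].
Qed.

Definition ext_contract (P : set A) : set R := [set a | P (ext_scalar a)].

Lemma prime_ext_contract P : prime_ideal P -> prime_ideal (ext_contract P).
Proof.
move=> /prime_idealP[iP P1 PM]; apply/prime_idealP; split=> //.
  apply: idealP; first exact: (ideal0 iP).
    by move=> u v Pu Pv; rewrite /ext_contract /= ext_scalarD; exact: idealD.
  by move=> a u Pu; rewrite /ext_contract /= ext_scalarM; exact: idealM.
by move=> u v; rewrite /ext_contract /= ext_scalarM => /PM.
Qed.

(** For [u] in [Q] the norm is a scalar of [Q], hence in [P], so [P] contains [u] or its conjugate.
    In the second case the trace is also a scalar of [Q], hence in [P], and [u] is the trace minus
    the conjugate. *)
Lemma ext_incomparable P Q : prime_ideal P -> prime_ideal Q ->
  P `<=` Q -> ext_contract Q `<=` ext_contract P -> Q `<=` P.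
Proof.
move=> /prime_idealP[iP _ PM] /prime_idealP[iQ _ _] PQ QP u Qu.
have /PM[//|Pu'] : P (u * ext_conj u).
  by rewrite ext_conjM; apply: QP; rewrite /ext_contract /= -ext_conjM;
     exact: idealMr.
rewrite -(addrK (ext_conj u) u) ext_conjD; apply: idealB => //.
apply: QP; rewrite /ext_contract /= -ext_conjD; apply: idealD => //.
exact: PQ.
Qed.

(* Lying over: [w] in [qA] satisfies [w ^ 2 - 2 w.1 w + N w = 0], so a scalar
   congruent to [w] modulo [J] has its square in [q]. *)
Lemma ext_going_up J q : ideal J -> prime_ideal q -> ext_contract J `<=` q ->
  exists Q, [/\ prime_ideal Q, J `<=` Q & ext_contract Q = q].
Proof.
move=> iJ /prime_idealP[iq q1 qM] Jq.
pose qA : set A := [set w | forall P : set A, ideal P ->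
   (forall a, q a -> P (ext_scalar a)) -> P w].
have iqA : ideal qA.
  apply: idealP => [P iP _|u v qu qv P iP qP|a u qu P iP qP].
  - exact: ideal0.
  - by apply: idealD; [|exact: qu|exact: qv].
  - by apply: idealM => //; exact: qu.
(* Elements of [qA] have their first component in [q] and their second in [qM]. *)
have qAN w : qA w -> q w.1 /\ q (ext_norm w).
  move=> qw; pose qM' : set M := span [set a *: x | a in q & x in setT].
  have sqM : submodule qM' by exact: submodule_span.
  have phi_q x y : qM' x -> q (phi x y).
    move=> qx; have : [set x | q (phi x y)] x; last by [].
    apply: (span_sub (N := [set x | q (phi x y)])) qx.
      apply/submoduleP; split; first by rewrite /= linear0l; exact: ideal0.
      move=> a u v /= qu qv; rewrite linearDl linearZl_LR /=.
      by apply: idealD => //; exact: idealM.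
    move=> _ [a qa [z _ <-]] /=; rewrite linearZl_LR; exact: idealMr.
  have [q1' q2] : [set u : A | q u.1 /\ qM' u.2] w.
    apply: qw => [|a qa]; last by split=> //; exact: submodule0.
    apply: idealP => /= [|u v [qu Mu] [qv Mv]|a u [qu Mu]].
    - by split; [exact: (ideal0 iq)|exact: (submodule0 sqM)].
    - by split; [exact: (idealD iq)|exact: (submoduleD sqM)].
    - split.
        by apply: (idealD iq); [exact: idealM|rewrite phiC; exact: phi_q].
      apply: (submoduleD sqM); first exact: (submoduleZ a.1 sqM).
      by apply: sub_span; exists u.1 => //; exists a.2.
  split=> //; apply: idealB => //; last exact: phi_q.
  by rewrite expr2; exact: idealM.
pose S : set A := [set u | exists2 s, ~ q s & u = ext_scalar s].
have JS u : ideal_add J qA u -> ~ S u.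
  move=> [v Jv [w qw vw]] [s qs uE]; apply: qs.
  have [qw1 qN] := qAN w qw.
  (* The polynomial is [(s - w)(s - ext_conj w)], whose first factor is [v]. *)
  have Js : J (ext_scalar (s ^+ 2 - (w.1 + w.1) * s + ext_norm w)).
    rewrite ext_scalarD -ext_conjM ext_scalarD ext_scalarN expr2 !ext_scalarM.
    rewrite -ext_conjD -uE -vw.
    rewrite (_ : _ + _ = v * (v + w - ext_conj w)); first exact: idealMr.
    by ring.
  have qs2 : q (s * s).
    rewrite (_ : s * s = (s ^+ 2 - (w.1 + w.1) * s + ext_norm w) +
        (w.1 + w.1) * s - ext_norm w); last by ring.
    apply: idealB => //; apply: idealD => //; first exact: Jq.
    by apply: idealMr => //; exact: idealD.
  by case/qM: qs2.
have iJqA := ideal_ideal_add iJ iqA.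
have [Q [iQ JQ QS Qmax]] := exists_maximal_disjoint iJqA JS.
have Qq : ext_contract Q `<=` q.
  by move=> a Qa; apply: contrapT => qa; apply: (QS _ Qa); exists a.
exists Q; split; last 1 first.
- apply/seteqP; split=> // a qa; apply: JQ; apply: sub_ideal_addr => //.
  by move=> P _; exact.
- apply/prime_idealP; split=> // [Q_1|u v Quv]; first by apply: q1; exact: Qq.
  apply: contrapT => nQ.
  (* By maximality [Q + (z)] contains a scalar outside [q]. Two of these, for [u] and [v], have
     their product in [Q] once [u * v] is. *)
  have meet z : ~ Q z -> exists s b, ~ q s /\ Q (ext_scalar s - b * z).
    move=> nQz; apply: contrapT => H; apply: nQz.
    apply: (Qmax (ideal_add Q (principal z))).
    - exact/ideal_ideal_add/ideal_principal.
    - exact/sub_ideal_addl/ideal_principal.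
    - move=> _ [c Qc [_ [b _ <-] <-]] [s qs sE]; apply: H; exists s, b.
      by rewrite -sE addrK.
    - exact: sub_ideal_addr iQ _ (principal_id _).
  have [|s [b [qs Qs]]] := meet u; first by move=> Qu; apply: nQ; left.
  have [|t [c [qt Qt]]] := meet v; first by move=> Qv; apply: nQ; right.
  have : q (s * t).
    apply: Qq; rewrite /ext_contract /= ext_scalarM.
    rewrite (_ : _ * _ = (ext_scalar s - b * u) * ext_scalar t +
      b * u * (ext_scalar t - c * v) + b * c * (u * v)); last by ring.
    apply: idealD => //; last exact: idealM.
    by apply: idealD => //; [exact: idealMr|exact: idealM].
  by case/qM.
- exact: subset_trans (sub_ideal_addl iqA) JQ.
Qed.

(** Contraction keeps inclusions strict by incomparability; conversely a chain is lifted from its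
    bottom by going up, starting over the zero ideal of [A]. *)
Lemma ext_prime_chain k : prime_chain A k <-> prime_chain R k.
Proof.
split=> [[P [pP ltP]]|[p [pp ltp]]].
  exists (fun i => ext_contract (P i)); split=> i ik.
    exact/prime_ext_contract/pP.
  have [PP nPP] := ltP i ik; split=> [a|]; first exact: PP.
  by move=> cPP; apply: nPP; apply: ext_incomparable => //; apply: pP => //;
     exact: ltnW.
(* The induction carries weak inclusions; strictness is recovered from the contractions. *)
suff [P PE] : exists P : nat -> set A, forall i, (i <= k)%N ->
    [/\ prime_ideal (P i), ext_contract (P i) = p i &
        forall j, (j < i)%N -> P j `<=` P i].
  exists P; split=> i ik; first by case: (PE i ik).
  have [_ cPi _] := PE i (ltnW ik); have [_ cPi1 PP] := PE i.+1 ik.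
  split; first exact: PP.
  by case: (ltp i ik) => _ + PP'; apply; rewrite -cPi -cPi1 => a; exact: PP'.
elim: k pp ltp => [|k IHk] pp ltp.
  have i0 : ideal (principal (0 : A)) by exact: ideal_principal.
  have [a [c _]|Q [pQ _ cQ]] := ext_going_up i0 (pp 0%N isT).
    rewrite mulr0 => -[<-]; apply: ideal0.
    by have [] := (prime_idealP _).1 (pp 0%N isT).
  by exists (fun=> Q) => i; rewrite leqn0 => /eqP->.
have [i ik|i ik|P PE] := IHk.
- by apply: pp; exact: ltnW.
- by apply: ltp; exact: ltnW.
have [pPk cPk PPk] := PE k (leqnn k).
have [iPk _ _] := (prime_idealP _).1 pPk.
have [|Q [pQ PQ cQ]] := ext_going_up iPk (pp k.+1 (leqnn _)).
  by rewrite cPk; case: (ltp k (leqnn _)).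
exists (fun i => if (i <= k)%N then P i else Q) => i ik.
have [ik'|ki] := leqP i k.
  have [pPi cPi PPi] := PE i ik'; split=> // j ji.
  by rewrite (leq_trans (ltnW ji) ik'); exact: PPi.
have -> : i = k.+1 by apply/eqP; rewrite eqn_leq ik ki.
split=> // j; rewrite ltnS => jk; rewrite jk; apply: subset_trans PQ.
by move: jk; rewrite leq_eqVlt => /orP[/eqP->//|]; exact: PPk.
Qed.

Lemma ext_krull_dim d : krull_dim R d -> krull_dim A d.
Proof.
move=> [cd dmax]; split; first exact/ext_prime_chain.
by move=> n /ext_prime_chain; exact: dmax.
Qed.

End Extension.

(** * Generators of modules *)

Section LinearTransport.
Variables (R : comNzRingType) (U V : lmodType R) (f : U -> V).
Hypotheses (f_linear : linear f) (f_inj : injective f).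

Lemma image_lincomb s : f @` lincomb setT s = lincomb setT (map f s).
Proof.
have f0 : f 0 = 0.
  by have := f_linear (-1) 0 0; rewrite scaler0 addr0 scaleN1r addNr.
elim: s => [|x s IHs] /=; first by rewrite image_set1 f0.
apply/seteqP; split=> [_ [_ [a [w [_ sw ->]]] <-]|_ [a [w [_ + ->]]]].
  exists a, (f w); split=> //; last exact: f_linear.
  by have : (f @` lincomb setT s) (f w) by [exists w]; rewrite IHs.
move=> tw; have : (f @` lincomb setT s) w by rewrite IHs.
case=> v sv <-; exists (a *: x + v); last exact: f_linear.
by exists a, v.
Qed.

Lemma generated_by_image (N : set U) k :
  generated_by (f @` N) k <-> generated_by N k.
Proof.
split=> /generated_byP[s sk Ns]; apply/generated_byP; last first.
  by exists (map f s); rewrite ?size_map// Ns image_lincomb.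
have [t st] : exists t, s = map f t.
  have : forall y, y \in s -> (f @` N) y.
    by move=> y ys; rewrite Ns; exact: lincombT_mem.
  elim: s {sk Ns} => [|y s IHs] sN; first by exists [::].
  have [x _ <-] := sN y (mem_head _ _).
  have [|t ->] := IHs; first by move=> z zs; apply: sN; rewrite inE zs orbT.
  by exists (x :: t).
exists t; first by rewrite -sk st size_map.
move: Ns; rewrite st -image_lincomb => fNt.
apply/seteqP; split=> u Nu.
  have : (f @` lincomb setT t) (f u) by rewrite -fNt; exists u.
  by case=> v tv /f_inj <-.
have : (f @` N) (f u) by rewrite fNt; exists u.
by case=> v Nv /f_inj <-.
Qed.

(** Serves to carry [mu] from [M] to [I] along [phi e], and from [m] to [I^2] along multiplication
    by [phi e e]. *)
Lemma mu_image (N : set U) k : mu (f @` N) k <-> mu N k.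
Proof.
by split=> -[/generated_by_image gk kmin]; split=> // l /generated_by_image;
   exact: kmin.
Qed.

End LinearTransport.

Section CyclicModules.
Variables (R : comNzRingType) (M : lmodType R).

Definition generator (e : M) : Prop := forall x, exists r : R, x = r *: e.

Lemma generated_by1_generator :
  generated_by [set: M] 1 <-> exists e, generator e.
Proof.
split=> [/generated_byP[[|e []]// _ Me]|[e Me]].
  exists e => x; have : [set: M] x by [].
  by rewrite Me => -[r [_ [_ -> ->]]]; exists r; rewrite addr0.
apply/generated_byP; exists [:: e] => //; apply/seteqP; split=> // x _.
by have [r ->] := Me x; exists r, 0; rewrite addr0.
Qed.

Lemma generated_by2_generators :
  generated_by [set: M] 2 <->
  exists e f, forall x : M, exists r s : R, x = r *: e + s *: f.
Proof.
split=> [/generated_byP[[|e [|f []]]// _ Mef]|[e [f Mef]]].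
  exists e, f => x; have : [set: M] x by [].
  rewrite Mef => -[r [_ [_ [s [_ [_ -> ->]]] ->]]].
  by exists r, s; rewrite addr0.
apply/generated_byP; exists [:: e; f] => //; apply/seteqP; split=> // x _.
have [r [s ->]] := Mef x; exists r, (s *: f); split=> //.
by exists s, 0; rewrite addr0.
Qed.

Lemma free_generatorP (e : M) : generator e ->
  (forall r : R, r *: e = 0 -> r = 0) -> free_generator e.
Proof.
move=> /choice[g gK] e0; exists g => [r|x]; last by rewrite -gK.
apply/eqP; rewrite -subr_eq0; apply/eqP; apply: e0.
by rewrite scalerBl -gK subrr.
Qed.

Lemma free_generator_generator (e : M) : free_generator e -> generator e.
Proof. by case=> g _ gK x; exists (g x); rewrite gK. Qed.

Lemma free_generator_isomorphic (e : M) :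
  free_generator e -> isomorphic M [set: R^o].
Proof.
case=> g eK gK.
have g_lin : linear (g : M -> R^o).
  move=> a x y; rewrite -[x in LHS]gK -[y in LHS]gK scalerA -scalerDl.
  exact: eK.
pose G := GRing.isLinear.Build _ _ _ _ (g : M -> R^o) g_lin.
pose h : {linear M -> R^o} := HB.pack (g : M -> R^o) G.
exists h; split=> // [x y _ _ /(congr1 (fun r => r *: e))|r _].
  by rewrite !gK.
by exists (r *: e).
Qed.

Lemma isomorphic_generator :
  isomorphic M [set: R^o] -> exists e : M, generator e.
Proof.
case=> f [_ finj fsurj]; have [e _ fe] := fsurj 1 I; exists e => x.
exists (f x); apply: finj; rewrite ?in_setT//.
by rewrite linearZ /= fe; rewrite [RHS]mulr1.
Qed.

End CyclicModules.

(** * Regularity of the extension *)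

Section ThreeGenerators.
Variables (R : comNzRingType) (m : set R).
Hypotheses (R_noetherian : noetherian R) (R_local : local_ring m).
Hypotheses (R_domain : domain R) (R_dim2 : prime_chain R 2).

Let im : ideal m := local_ideal R_local.

Lemma domain_eq0 (u v : R) : u * v = 0 -> u = 0 \/ v = 0.
Proof. by move/R_domain/orP=> [/eqP|/eqP]; [left|right]. Qed.

(* If [m] had two generators, any of its elements outside [m ^ 2] would
   generate a prime ideal; the relation then makes [m] principal. *)
Lemma quadric_not_generated_by2 (p q r : R) :
  (forall u, m u <-> exists a b c, u = a * p + b * q + c * r) ->
  p * r = q ^+ 2 -> ~ generated_by (m : set R^o) 2.
Proof.
move=> mE prq /generated_by2P[x [y mxy]].
have not_principal z : ~ m `<=` principal z \/ ~ m z.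
  have [mz|] := pselect (m z); last by right.
  left=> mz'; apply: (not_principal_max R_noetherian R_local R_dim2 (z := z)).
  by apply/seteqP; split=> //; exact: principal_sub.
have mp : m p by apply/mE; exists 1, 0, 0; ring.
have mq : m q by apply/mE; exists 0, 1, 0; ring.
have mr : m r by apply/mE; exists 0, 0, 1; ring.
(* Stated for either end of the quadric. If [(p')] is prime, it contains [q]; with [q = c p'],
   cancelling [p'] gives [r' = c ^ 2 p'], so [m] is [(p')]. *)
have edge p' r' : m p' -> p' * r' = q ^+ 2 ->
    (forall u, m u -> exists a b c, u = a * p' + b * q + c * r') ->
    ideal_mul m m p'.
  move=> mp' prq' mE'; apply: contrapT => np'.
  have [y' mE2] := exchange_generator R_local mxy mp' np'.
  have pp := prime_generator R_noetherian R_local mE2 R_dim2.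
  have [|c _ qE] := primeX (k := 2%N) (u := q) pp.
    by rewrite -prq'; exists r'; rewrite // mulrC.
  have [p0|rE] : p' = 0 \/ r' - c ^+ 2 * p' = 0.
    by apply: domain_eq0; rewrite mulrBr prq' -qE; ring.
    by apply: np'; rewrite p0; exact: (ideal0 (ideal_ideal_mul _ _)).
  case: (not_principal p') => // -[] u /mE'[a [b [d ->]]].
  exists (a + b * c + d * c ^+ 2) => //.
  by rewrite -(subrK (c ^+ 2 * p') r') rE -qE; ring.
have mmp : ideal_mul m m p by apply: (edge _ r) => // u /mE.
have mmr : ideal_mul m m r.
  apply: (edge _ p) => //; first by rewrite mulrC.
  by move=> u /mE[a [b [c ->]]]; exists c, b, a; ring.
(* With both ends in [m^2], Nakayama's lemma leaves [q] as the only generator. *)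
case: (not_principal q) => // -[].
apply: (nakayama_ideal R_noetherian R_local) => //.
  exact: ideal_principal.
move=> u /mE[a [b [c ->]]]; exists (b * q); first by exists b.
exists (a * p + c * r); last by ring.
have imm := ideal_ideal_mul m m.
by apply: (idealD imm); exact: (idealM _ imm).
Qed.

End ThreeGenerators.

(** * Generators of the maximal ideal of the extension *)

Section RegularExtension.
Variables (R : comNzRingType) (m : set R).
Hypotheses (R_noetherian : noetherian R) (R_local : local_ring m).
Variables (M : lmodType R) (phi : {biscalar M}).
Hypotheses (M_nonzero : exists x : M, x != 0) (M_fg : fgen [set: M]).
Hypotheses (phiC : phi_sym phi) (phiA : phi_assoc phi).
Hypothesis phi_m : forall x y : M, m (phi x y).

Local Notation A := (extension phiC phiA).
Local Notation n := (@ext_max R m M phi phiC phiA).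
Local Notation scalar := (ext_scalar phiC phiA).
Local Notation vector := (ext_vector phiC phiA).
Let im : ideal m := local_ideal R_local.
Let ideal_n : ideal n := ideal_ext_max R_local phiC phiA phi_m.

Let mM : set M := span [set a *: x | a in m & x in setT].

Let smM : submodule mM.
Proof. exact: submodule_span. Qed.

Let mMI a x : m a -> mM (a *: x).
Proof. by move=> ma; apply: sub_span; exists a => //; exists x. Qed.

Lemma ideal_phi_ideal : ideal (phi_ideal phi).
Proof. exact: (submodule_span (V := R^o)). Qed.

Lemma phi_ideal_mem x y : phi_ideal phi (phi x y).
Proof. by apply: (sub_span (V := R^o)); exists x, y. Qed.

Lemma phi_ideal_sub I : ideal I -> (forall x y, I (phi x y)) ->
  phi_ideal phi `<=` I.
Proof. by move=> iI Iphi; apply: (span_sub iI) => _ [x [y ->]]. Qed.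

Lemma generator_phi_ideal (e : M) :
  generator e -> phi_ideal phi = principal (phi e e).
Proof.
move=> Me; apply/seteqP; split.
  apply: phi_ideal_sub => [|x y]; first exact: ideal_principal.
  have [r ->] := Me x; have [s ->] := Me y.
  by rewrite linearZl_LR linearZr_LR /=; exists (r * s); rewrite // mulrA.
exact: principal_sub ideal_phi_ideal (phi_ideal_mem e e).
Qed.

(** Because [(r, c e) (0, e) = (c phi(e,e), r e)], multiples of [vector e] reach both components
    independently. *)
Lemma ext_max_principal e : generator e -> m = principal (phi e e) ->
  n = principal (vector e).
Proof.
move=> Me mE; apply/seteqP; split.
  move=> [a x] /=; rewrite /ext_max /= mE => -[c _ <-].
  have [r ->] := Me x; exists ((r, c *: e) : A) => //.
  by rewrite ext_mulE /= mulr0 add0r scale0r addr0 linearZl_LR.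
apply: principal_sub => //; exact: ideal0 im.
Qed.

Lemma ext_max_cyclic e y : generator e -> m = ideal2 (phi e e) y ->
  n = ideal2 (vector e) (scalar y).
Proof.
move=> Me mE; apply/seteqP; split.
  move=> [a x] /=; rewrite /ext_max /= mE => -[c [b ->]].
  have [r ->] := Me x; exists ((r, c *: e) : A), (scalar b).
  rewrite -ext_scalarM ext_mulE /= ext_addE /= mulr0 add0r scale0r !addr0.
  by rewrite linearZl_LR.
apply: ideal2_sub => //; first exact: ideal0 im.
by rewrite /ext_max /= mE; exact: ideal2r.
Qed.

(** The two vectors generate all vectors, and products of vectors are the scalars [phi x y], which
    generate [m]. *)
Lemma ext_max_vectors e f :
  (forall x, exists r s : R, x = r *: e + s *: f) -> phi_ideal phi = m ->
  n = ideal2 (vector e) (vector f).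
Proof.
move=> Mef mE; have iN := ideal_ideal2 (vector e) (vector f).
apply/seteqP; split; last first.
  by apply: ideal2_sub => //; exact: ideal0 im.
have Nv x : ideal2 (vector e) (vector f) (vector x).
  have [r [s ->]] := Mef x; exists (scalar r), (scalar s).
  by rewrite !ext_scalar_mul /= !mulr0 ext_addE /= addr0.
have Ns a : m a -> ideal2 (vector e) (vector f) (scalar a).
  rewrite -mE => ma; apply: (phi_ideal_sub 
    (I := [set b | ideal2 (vector e) (vector f) (scalar b)])) ma.
    apply: idealP => /= [|u v Nu Nw|b u Nu]; first exact: ideal0 iN.
      by rewrite ext_scalarD; exact: (idealD iN).
    by rewrite ext_scalarM; exact: (idealM _ iN).
  by move=> x y /=; rewrite -ext_vectorM; exact: (idealM _ iN).
move=> [a x] ma; rewrite (_ : (a, x) = scalar a + vector x); last first.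
  by rewrite ext_addE /= addr0 add0r.
by apply: (idealD iN) => //; exact: Ns.
Qed.

Let m2 := ideal_mul m m.

Lemma ext_max_mul_fst u v :
  n u -> n v -> ideal_add (phi_ideal phi) m2 (u * v).1.
Proof.
move=> nu nv; rewrite ext_mulE /=; exists (phi u.2 v.2).
  exact: phi_ideal_mem.
by exists (u.1 * v.1); [exact: ideal_mulP|rewrite addrC].
Qed.

Let iphi2 : ideal (ideal_add (phi_ideal phi) m2).
Proof. exact: ideal_ideal_add ideal_phi_ideal (ideal_ideal_mul _ _). Qed.

Lemma phi_ideal_eq : m `<=` ideal_add (phi_ideal phi) m2 -> phi_ideal phi = m.
Proof.
move=> H; apply/seteqP; split; first exact: phi_ideal_sub.
exact: (nakayama_ideal R_noetherian R_local im ideal_phi_ideal H).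
Qed.

Lemma nakayama_module (N : set M) : submodule N ->
  (forall x, exists y z, [/\ N y, mM z & x = y + z]) -> forall x, N x.
Proof.
by move=> sN H x; exact: (nakayama R_local M_fg sN (fun v _ => H v)).
Qed.

(** A unit [c] would give [M = mM], hence [M = 0]. *)
Lemma generator_unit (e : M) c : generator e -> mM (c *: e) -> m c.
Proof.
move=> Me mce; apply: contrapT => /(local_cancel R_local smM)/(_ mce) me.
have [x /eqP] := M_nonzero; apply.
apply: (nakayama_module (N := [set 0])) => [|{}x].
  by apply/submoduleP; split=> // a u v -> ->; rewrite scaler0 addr0.
exists 0, x; split=> //; last by rewrite add0r.
by have [r ->] := Me x; exact: (submoduleZ r smM).
Qed.

Let mM_max u (w : A) : n u -> mM (u.1 *: w.2).
Proof. exact: mMI. Qed.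

(** Comparing second components gives [M = R u.2 + mM]. If [scalar a = w u], the vanishing second
    component forces [w.1] into [m], so [a] is a first component of [n^2]. *)
Lemma regular_extension1 u : n = principal u ->
  exists2 e : M, generator e & phi_ideal phi = m.
Proof.
move=> nE; have nu : n u by rewrite nE; exact: principal_id.
have Me : generator u.2.
  pose N : set M := [set x | exists r : R, x = r *: u.2].
  apply: (nakayama_module (N := N)) => [|x].
    apply/submoduleP; split; first by exists 0; rewrite scale0r.
    by move=> a _ _ [r ->] [s ->]; exists (a * r + s); rewrite scalerDl scalerA.
  have : n (vector x) by exact: ideal0 im.
  rewrite nE => -[w _ /(congr1 snd) /= wu].
  exists (w.1 *: u.2), (u.1 *: w.2); split; first by exists w.1.
    exact: mM_max.
  exact: esym wu.
exists u.2 => //; apply: phi_ideal_eq => a ma.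
have : n (scalar a) by [].
rewrite nE => -[w _ wu]; have := congr1 fst wu => /= <-.
apply: ext_max_mul_fst => //; apply: (generator_unit Me).
rewrite (_ : w.1 *: u.2 = - (u.1 *: w.2)).
  by apply: (submoduleN smM); exact: mM_max.
by apply/eqP; rewrite -addr_eq0; apply/eqP; exact: (congr1 snd wu).
Qed.

Lemma regular_extension2_span u v : n = ideal2 u v ->
  forall x, exists r s : R, x = r *: u.2 + s *: v.2.
Proof.
move=> nE; have nu : n u by rewrite nE; exact: ideal2l.
have nv : n v by rewrite nE; exact: ideal2r.
pose N : set M := [set x | exists r s : R, x = r *: u.2 + s *: v.2].
apply: (nakayama_module (N := N)) => [|x].
  apply/submoduleP; split; first by exists 0, 0; rewrite !scale0r addr0.
  move=> a _ _ [r [s ->]] [r' [s' ->]]; exists (a * r + r'), (a * s + s').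
  by rewrite !scalerDl scalerDr !scalerA addrACA.
have : n (vector x) by exact: ideal0 im.
rewrite nE => -[a [b /(congr1 snd) /= ->]].
exists (a.1 *: u.2 + b.1 *: v.2), (u.1 *: a.2 + v.1 *: b.2); split.
- by exists a.1, b.1.
- by apply: (submoduleD smM); exact: mM_max.
- by rewrite addrACA.
Qed.

(** The vector part of [scalar c] vanishes, and its remaining terms have coefficients [u.1], [v.1]
    in [m]. This is the source of every claim that the coefficients of a scalar lie in [n]. *)
Lemma ext_max_relation u v a b c : n u -> n v ->
  scalar c = a * u + b * v -> mM (a.1 *: u.2 + b.1 *: v.2).
Proof.
move=> nu nv /(congr1 snd) /= /esym/eqP; rewrite addrACA addr_eq0 => /eqP->.
by apply: (submoduleN smM); apply: (submoduleD smM); exact: mM_max.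
Qed.

Lemma regular_extension2_cyclic u v (e : M) : n = ideal2 u v -> generator e ->
  exists (e' : M) b, generator e' /\ m = ideal2 (phi e' e') b.
Proof.
move=> nE Me; have Muv := regular_extension2_span nE.
(* If both [u.2] and [v.2] were multiples of [e] by elements of [m], then [e] would lie in [mM]. *)
wlog [c [nmc uE]] : u v nE Muv / exists c, ~ m c /\ u.2 = c *: e.
  move=> wl; have [c uE] := Me u.2; have [d vE] := Me v.2.
  have [mc|nmc] := pselect (m c); last by apply: (wl u v) => //; exists c.
  have [md|nmd] := pselect (m d); last first.
    apply: (wl v u); [by rewrite ideal2C| |by exists d].
    by move=> x; have [r [s ->]] := Muv x; exists s, r; rewrite addrC.
  case: (local_proper R_local); apply: (generator_unit Me); rewrite scale1r.
  have [r [s ->]] := Muv e; rewrite uE vE.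
  by apply: (submoduleD smM); apply: (submoduleZ _ smM); exact: mMI.
have nu : n u by rewrite nE; exact: ideal2l.
have nv : n v by rewrite nE; exact: ideal2r.
have Mu : generator u.2.
  have [c' cc'] := local_unit R_local nmc.
  move=> x; have [r ->] := Me x; exists (r * c').
  by rewrite uE scalerA -mulrA cc' mulr1.
(* Subtracting [scalar r * u] from [v] removes its vector part; the scalar that remains is the
   second generator. *)
have [r vE] := Mu v.2; exists u.2, (v.1 - r * u.1); split=> //.
have i2 := ideal_ideal2 (phi u.2 u.2) (v.1 - r * u.1).
apply/seteqP; split; last first.
  by apply: ideal2_sub => //; apply: idealB => //; exact: idealM.
apply: (nakayama_ideal R_noetherian R_local) => // a ma.
have : n (scalar a) by [].
rewrite nE => -[w [t wt]].
have mwt : m (w.1 + r * t.1).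
  apply: (generator_unit Mu); have := ext_max_relation nu nv wt.
  by rewrite vE scalerA -scalerDl mulrC.
have bE : v - scalar r * u = scalar (v.1 - r * u.1).
  by rewrite ext_scalar_mul ext_oppE ext_addE /= vE subrr.
have -> : a = ((w + t * scalar r) * u).1 + t.1 * (v.1 - r * u.1).
  have -> : a = (w * u + t * v).1 by rewrite -wt.
  rewrite (_ : w * u + t * v =
    (w + t * scalar r) * u + scalar (v.1 - r * u.1) * t); last first.
    by rewrite -bE; ring.
  by rewrite ext_scalar_mul ext_addE [in LHS]/= [in RHS](mulrC t.1).
have nwt : n (w + t * scalar r).
  by rewrite /ext_max /= linear0r addr0 mulrC.
have [k phik [l ml <-]] := ext_max_mul_fst nwt nu.
exists (k + t.1 * (v.1 - r * u.1)); last by exists l => //; rewrite addrAC.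
apply: (idealD i2); last by apply: (idealM _ i2); exact: ideal2r.
move: phik; rewrite (generator_phi_ideal Mu); apply: principal_sub => //.
exact: ideal2l.
Qed.

(** As [M] is not cyclic, [u.2] and [v.2] are independent modulo [mM]; writing
    [scalar a = w u + t v] then forces [w] and [t] into [n], so [a] is a first component of
    [n^2]. *)
Lemma regular_extension2_noncyclic u v : n = ideal2 u v ->
  ~ (exists e : M, generator e) -> phi_ideal phi = m.
Proof.
move=> nE ncyc; have Muv := regular_extension2_span nE.
have nu : n u by rewrite nE; exact: ideal2l.
have nv : n v by rewrite nE; exact: ideal2r.
have indep x y r s : (forall z, exists a b : R, z = a *: x + b *: y) ->
    mM (r *: x + s *: y) -> m r.
  move=> Mxy mrs; apply: contrapT => /(local_unit R_local)[r' rr'].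
  apply: ncyc; exists y.
  pose N : set M := [set z | exists a : R, z = a *: y].
  apply: (nakayama_module (N := N)) => [|z].
    apply/submoduleP; split; first by exists 0; rewrite scale0r.
    by move=> a _ _ [b ->] [c ->]; exists (a * b + c); rewrite scalerDl scalerA.
  have [a [b ->]] := Mxy z.
  exists ((b - a * r' * s) *: y), ((a * r') *: (r *: x + s *: y)); split.
  - by exists (b - a * r' * s).
  - exact: (submoduleZ _ smM).
  - rewrite scalerDr !scalerA -(mulrA a r' r) rr' mulr1 addrCA -scalerDl.
    by rewrite subrK.
apply: phi_ideal_eq => a ma; have : n (scalar a) by [].
rewrite nE => -[w [t wt]]; have mwt := ext_max_relation nu nv wt.
have nw : n w by exact: indep mwt.
have nt : n t.
  apply: (indep v.2 u.2 t.1 w.1); last by rewrite addrC.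
  by move=> x; have [r [s ->]] := Muv x; exists s, r; rewrite addrC.
have -> : a = (w * u).1 + (t * v).1 by have := congr1 fst wt.
by apply: (idealD iphi2); exact: ext_max_mul_fst.
Qed.

End RegularExtension.

(** * The non-cyclic case in dimension two *)

Section HypersurfaceCase.
Variables (R : comNzRingType) (m : set R).
Hypotheses (R_noetherian : noetherian R) (R_local : local_ring m).
Hypothesis R_dim : krull_dim R 2.
Variables (M : lmodType R) (phi : {biscalar M}).
Hypotheses (phiC : phi_sym phi) (phiA : phi_assoc phi).
Hypothesis phi_m : forall x y : M, m (phi x y).
Hypothesis A_domain : domain (extension phiC phiA).
Hypothesis M_noncyclic : ~ exists e : M, generator e.
Hypothesis M_gen2 : generated_by [set: M] 2.
Hypothesis phi_max : phi_ideal phi = m.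

Lemma ext_domain_scalar : domain R.
Proof.
move=> a b ab0.
have : ext_scalar phiC phiA a * ext_scalar phiC phiA b = 0.
  by rewrite -ext_scalarM ab0.
by move/A_domain/orP=> [/eqP[->]|/eqP[->]]; rewrite eqxx ?orbT.
Qed.

Lemma ext_domain_phi (x y : M) : phi x y = 0 -> x = 0 \/ y = 0.
Proof.
move=> xy0; have : ext_vector phiC phiA x * ext_vector phiC phiA y = 0.
  by rewrite ext_vectorM xy0.
by move/A_domain/orP=> [/eqP[->]|/eqP[->]]; [left|right].
Qed.

Lemma hypersurface_case :
  [/\ ~ regular_local R, hypersurface R & domain R] /\
  exists I : set R, [/\ ideal I, isomorphic M (I : set R^o),
    mu (I : set R^o) 2 & mu (ideal_mul I I : set R^o) 3].
Proof.
have im := local_ideal R_local.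
have [e [f Mef]] := (generated_by2_generators M).1 M_gen2.
pose p := phi e e; pose q := phi e f; pose r := phi f f.
(* Apply [phi _ f] to [phi e e *: f = phi e f *: e]. *)
have prq : p * r = q ^+ 2.
  rewrite /p /r -linearZl_LR /= (phiA e e f) linearZl_LR /= expr2.
  by [].
have mE u : m u <-> exists a b c, u = a * p + b * q + c * r.
  split=> [|[a [b [c ->]]]]; last first.
    by apply: (idealD im); [apply: (idealD im)|]; apply: (idealM _ im);
       exact: phi_m.
  rewrite -phi_max => mu.
  pose K : set R := [set v | exists a b c, v = a * p + b * q + c * r].
  apply: (phi_ideal_sub (I := K)) mu.
    apply: idealP => [|_ _ [a [b [c ->]]] [a' [b' [c' ->]]]|d _ [a [b [c ->]]]].
    - by exists 0, 0, 0; ring.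
    - by exists (a + a'), (b + b'), (c + c'); ring.
    - by exists (d * a), (d * b), (d * c); ring.
  move=> x y; have [a [b ->]] := Mef x; have [a' [b' ->]] := Mef y.
  exists (a * a'), (a * b' + b * a'), (b * b').
  rewrite linearDl !linearDr !linearZl_LR !linearZr_LR /= (phiC f e) /p /q /r.
  by ring.
have mgen3 : generated_by (m : set R^o) 3.
  apply/generated_byP; exists [:: (p : R^o); q : R^o; r : R^o] => //.
  apply/seteqP; split=> u.
    move=> /mE[a [b [c ->]]]; exists a, (b * q + c * r); split=> //.
      by exists b, (c * r); split=> //; exists c, 0; split=> //; rewrite addr0.
    by rewrite -addrA.
  move=> [a [_ [_ [b [_ [_ [c [_ [_ -> ->]]] ->]]] ->]]].
  by apply/mE; exists a, b, c; rewrite addr0 -addrA.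
have domR := ext_domain_scalar.
have ngen2 :=
  quadric_not_generated_by2 R_noetherian R_local domR R_dim.1 mE prq.
have mu3 : mu (m : set R^o) 3.
  split=> // k mk; rewrite leqNgt; apply/negP; rewrite ltnS => k2.
  exact: ngen2 (generated_by_leq k2 mk).
have e0 : e <> 0.
  move=> e0; apply: M_noncyclic; exists f => x.
  by have [a [b ->]] := Mef x; exists b; rewrite e0 scaler0 add0r.
(* [phi e x = 0] makes the product of the vectors [e] and [x] vanish in the domain [A]; as [e] is
   nonzero, [g] is injective. *)
pose g : M -> R^o := phi e.
have g_lin : linear g.
  by move=> a x y; rewrite /g linearDr linearZr_LR.
have g_inj : injective g.
  move=> x y gxy; apply/eqP; rewrite -subr_eq0; apply/eqP.
  have [|//|//] := ext_domain_phi (x := e) (y := x - y).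
  by rewrite linearBr; apply/eqP; rewrite subr_eq0; exact/eqP.
have p0 : p <> 0 by case/ext_domain_phi.
pose h : R^o -> R^o := *%R p.
have h_lin : linear h.
  by move=> a x y; rewrite /h mulrDr; congr (_ + _); exact: mulrCA.
have h_inj : injective h.
  move=> x y hxy; apply/eqP; rewrite -subr_eq0; apply/eqP.
  have [|//|//] := domain_eq0 domR (u := p) (v := x - y).
  by rewrite mulrBr; apply/eqP; rewrite subr_eq0; exact/eqP.
pose I : set R := g @` setT.
have phi2 x y : phi e x * phi e y = p * phi x y.
  rewrite -linearZl_LR /= (phiC e x) (phiA x e e) linearZl_LR /=.
  by [].
(* Since [phi(M,M) = m], the identity [phi2] gives [I^2 = p m], and [p] is nonzero, so
   [mu(I^2) = mu(m) = 3]. *)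
have I2E : ideal_mul I I = h @` m.
  have ihm : ideal (h @` m).
    apply: idealP; first by exists 0; [exact: ideal0|exact: mulr0].
      move=> _ _ [u mu <-] [v mv <-]; exists (u + v); first exact: idealD.
      exact: mulrDr.
    move=> a _ [u mu <-]; exists (a * u); first exact: idealM.
    exact: mulrCA.
  apply/seteqP; split.
    apply: ideal_mul_sub => // _ _ [x _ <-] [y _ <-].
    by rewrite /g phi2; exists (phi x y).
  move=> _ [u mu <-]; rewrite -phi_max in mu.
  have iK : ideal [set v | ideal_mul I I (h v)].
    have iII := ideal_ideal_mul I I.
    apply: idealP => /= [|v w Iv Iw|a v Iv].
    - by rewrite /h mulr0; exact: ideal0 iII.
    - by rewrite /h mulrDr; exact: (idealD iII).
    - by rewrite /h mulrCA; exact: (idealM _ iII).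
  apply: (phi_ideal_sub iK) mu => x y /=.
  by rewrite /h -phi2; apply: ideal_mulP; [exists x|exists y].
split.
  split=> //.
    by move/(regular_local_mu R_noetherian R_local R_dim) => -[].
  by exists 2%N, 3%N; split=> //; exact/(embdimP R_local).
exists I; split.
- apply: (generated_by_submodule (V := R^o) (n := 2)).
  exact/(generated_by_image g_lin g_inj).
- pose G := GRing.isLinear.Build _ _ _ _ g g_lin.
  pose g' : {linear M -> R^o} := HB.pack g G.
  exists g'; split=> [x _|x y _ _ /g_inj//|_ [x _ <-]]; first by exists x.
  by exists x.
- apply/(mu_image g_lin g_inj); split=> // k Mk; rewrite leqNgt; apply/negP.
  rewrite ltnS => k1; apply/M_noncyclic/generated_by1_generator.
  exact: generated_by_leq Mk.
- by rewrite I2E; apply/(mu_image h_lin h_inj).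
Qed.

End HypersurfaceCase.

(** * The classification in dimensions zero, one and two *)

Unset Implicit Arguments.

Theorem corollary7p8 (R : comNzRingType) (m : set R) (d : nat)
    (R_noetherian : noetherian R) (R_local : local_ring m)
    (R_dim : krull_dim R d)
    (M : lmodType R) (M_nonzero : exists x : M, x != 0)
    (M_fg : finitely_generated [set: M])
    (phi : {biscalar M}) (phiC : phi_sym phi) (phiA : phi_assoc phi)
    (phi_m : forall x y : M, m (phi x y)) :
  [/\ d = 0%N -> ~ regular_local (extension phiC phiA),
      d = 1%N ->
        (regular_local (extension phiC phiA) <->
         [/\ dvr R, isomorphic M [set: R^o] & phi_ideal phi = m])
    & d = 2%N ->
        (regular_local (extension phiC phiA) <->
         [/\ regular_local R, isomorphic M [set: R^o]
           & exists e : M, free_generator e /\ ~ ideal_mul m m (phi e e)]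
         \/
         [/\ [/\ ~ regular_local R, hypersurface R & domain R],
             exists I : set R,
               [/\ ideal I, isomorphic M (I : set R^o),
                   mu (I : set R^o) 2 & mu (ideal_mul I I : set R^o) 3]
           & phi_ideal phi = m])].
Proof.
move: M_fg => /fgenP Mfg.
pose n := @ext_max R m M phi phiC phiA.
have im := local_ideal R_local.
have nloc : local_ring n := ext_local R_local phiC phiA phi_m.
have nnoeth : noetherian (extension phiC phiA).
  exact: (ext_noetherian R_noetherian Mfg).
have regE k : krull_dim R k ->
    regular_local (extension phiC phiA) <->
    mu (n : set (extension phiC phiA)^o) k.
  by move=> Rk; apply: regular_local_mu => //; exact: ext_krull_dim.
(* A nonzero vector lies in [n]. This settles [d = 0] and gives minimality of one generator for
   [d = 1]. *)
have n0 : ~ generated_by (n : set (extension phiC phiA)^o) 0.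
  move=> /generated_byP[[]// _ nE]; have [x /eqP] := M_nonzero; apply.
  have : n (ext_vector phiC phiA x) by exact: ideal0 im.
  by rewrite nE => -[].
split=> dE; move: R_dim; rewrite {}dE => R_dim.
- by move=> /(regE _ R_dim)[].
- split=> [/(regE _ R_dim)[/generated_by1P[u nE] _]|]; last first.
    move=> [_ /isomorphic_generator[e Me] mE].
    apply/(regE _ R_dim); split.
      apply/generated_by1P; exists (ext_vector phiC phiA e).
      apply: ext_max_principal => //.
      by rewrite -mE; exact: generator_phi_ideal.
    by case=> // /n0.
    have [e Me mE] :=
      regular_extension1 R_noetherian R_local M_nonzero Mfg phi_m nE.
    have mpe : m = principal (phi e e).
      by rewrite -mE; exact: generator_phi_ideal.
    have dvrR := principal_max_dvr R_noetherian R_local mpe R_dim.1.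
    split=> //; apply/free_generator_isomorphic/free_generatorP.
      exact: Me.
    (* From [r e = 0] follows [r phi(e,e) = 0], and [phi e e] is nonzero because it generates
       [m]. *)
    move=> r re0; have [domR _ [m' [lm' m'0]]] := dvrR.
    have [//|phi0] : r = 0 \/ phi e e = 0.
      by apply: domain_eq0 => //; rewrite -linearZl_LR /= re0 linear0l.
    case: m'0; rewrite (R_local.2 m' lm'.1) mpe phi0.
    apply/seteqP; split=> [_ [c _ <-]|_ ->]; first by rewrite mulr0.
    by exists 0; rewrite ?mulr0.
have A_dim := ext_krull_dim phiC phiA R_dim.
split=> [/(regE _ R_dim)[/generated_by2P[u [v nE]] _]|].
  have domA := domain_dim2 nnoeth nloc nE A_dim.1.
  have domR := ext_domain_scalar domA.
  have [[e0 Me0]|ncyc] := pselect (exists e : M, generator e); [left|right].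
    have [e [b [Me mE]]] :=
      regular_extension2_cyclic R_noetherian R_local M_nonzero Mfg phi_m nE Me0.
    (* Otherwise Nakayama's lemma would leave [b] as the only generator of [m], which dimension two
       excludes. *)
    have phi2 : ~ ideal_mul m m (phi e e).
      move=> phi2.
      apply: (not_principal_max R_noetherian R_local R_dim.1 (z := b)).
      have mb : m b by rewrite mE; exact: ideal2r.
      apply/seteqP; split; last exact: principal_sub.
      apply: (nakayama_ideal R_noetherian R_local) => //.
        exact: ideal_principal.
      move=> w; rewrite {1}mE => -[c [c' ->]].
      exists (c' * b); first by exists c'.
      exists (c * phi e e); last by rewrite addrC.
      exact: (idealM _ (ideal_ideal_mul m m)).
    have fe : free_generator e.
      apply: free_generatorP => // r re0.
      have [//|phi0] : r = 0 \/ phi e e = 0.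
        by apply: domain_eq0 => //; rewrite -linearZl_LR /= re0 linear0l.
      by case: phi2; rewrite phi0; exact: (ideal0 (ideal_ideal_mul m m)).
    split; [|exact: free_generator_isomorphic fe|by exists e].
    apply/(regular_local_mu R_noetherian R_local R_dim).
    exact: mu2_max R_noetherian R_local _ _ R_dim.1 mE.
  have phi_max :=
    regular_extension2_noncyclic R_noetherian R_local Mfg phi_m nE ncyc.
  have Mgen2 : generated_by [set: M] 2.
    apply/generated_by2_generators; exists u.2, v.2.
    exact: (regular_extension2_span R_local Mfg nE).
  have [RI I23] := hypersurface_case R_noetherian R_local R_dim phi_m domA
    ncyc Mgen2 phi_max.
  by split.
(* Both alternatives need only produce two generators of [n]; their minimality follows from
   [dim A = 2]. *)
suff ngen :
    regular_local R /\
      (exists e : M, free_generator e /\ ~ ideal_mul m m (phi e e)) \/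
    generated_by [set: M] 2 /\ phi_ideal phi = m ->
    exists u v, n = ideal2 u v.
  move=> H; have [|u [v nE]] := ngen.
    case: H => [[regR _ He]|[_ [I [_ [f [fI finj fsurj]] [I2 _] _]] phim]].
      by left.
    (* Two generators of [I] are pulled back to [M] along the isomorphism. *)
    right; split=> //; apply/(generated_by_image (f := f)).
    - exact: linearP.
    - by move=> x y; apply: finj; rewrite in_setT.
    rewrite (_ : f @` setT = I) //; apply/seteqP; split=> //.
    by move=> _ [x _ <-]; exact: fI.
  apply/(regE _ R_dim); exact: (mu2_max nnoeth nloc A_dim.1 nE).
case=> [[regR [e [fe phi2]]]|[Mgen2 phim]].
  have [/generated_by2P[a [b mab]] _] :=
    (regular_local_mu R_noetherian R_local R_dim).1 regR.
  have [y mE] := exchange_generator R_local mab (phi_m e e) phi2.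
  exists (ext_vector phiC phiA e), (ext_scalar phiC phiA y).
  by apply: ext_max_cyclic => //; exact: free_generator_generator.
have [e [f Mef]] := (generated_by2_generators M).1 Mgen2.
exists (ext_vector phiC phiA e), (ext_vector phiC phiA f).
exact: (ext_max_vectors R_local).
Qed.
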